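(* Let $q\in(0,1)$, let $j_1,j_2\in\{0,\tfrac12,1,\tfrac32,\dots\}$, $j\in\{|j_1-j_2|,|j_1-j_2|+1,\dots,j_1+j_2\}$, $m_i\in\{-j_i,-j_i+1,\dots,j_i\}$ for $i=1,2$, and assume $m:=m_1+m_2$ satisfies $-j\le m\le j$. Put $$s=j_2-m_2,\quad n=j-m,\quad N=j_1+j_2-m+1,\quad \alpha=m-j_1+j_2,\quad \beta=m+j_1-j_2,$$ and assume $\alpha>-1$ and $\beta>-1$. Then $$(-1)^{j_1-m_1}\langle j_1m_1,j_2m_2|jm\rangle_q=\sqrt{\frac{\rho(s)\,\bigl(x(s+\tfrac12)-x(s-\tfrac12)\bigr)}{d_n^2}}\;h_n^{\alpha,\beta}(x(s),N)_q,$$ where $h_n^{\alpha,\beta}(x(s),N)_q$ are the $q$-Hahn polynomials on the lattice $x(s)=\frac{q^{2s}-1}{q^2-1}$, $\rho$ is their weight function and $d_n^2$ their squared norm.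
   Context: Notation. For real $q>0$, $q\ne1$: $[x]_q=\frac{q^x-q^{-x}}{q-q^{-1}}$ for $x\in\mathbb R$; $[0]_q!=1$ and $[n]_q!=[1]_q\cdots[n]_q$ for $n\in\mathbb N$; $(a|q)_0=1$, $(a|q)_k=\prod_{i=0}^{k-1}[a+i]_q$. Representations. For $j\in\{0,\frac12,1,\dots\}$, $D^j$ is the complex inner product space with orthonormal basis $|jm\rangle$, $m=-j,-j+1,\dots,j$, and operators $$J_0|jm\rangle=m|jm\rangle,\quad J_-|jm\rangle=\sqrt{[j+m]_q[j-m+1]_q}\,|j\,m-1\rangle,\quad J_+|jm\rangle=\sqrt{[j-m]_q[j+m+1]_q}\,|j\,m+1\rangle,$$ and $q^{aJ_0}|jm\rangle=q^{am}|jm\rangle$. On $D^{j_1}\otimes D^{j_2}$ (orthonormal basis $|j_1m_1\rangle|j_2m_2\rangle$) put $J_0(12)=J_0\otimes1+1\otimes J_0$ and $J_\pm(12)=J_\pm\otimes q^{J_0}+q^{-J_0}\otimes J_\pm$. Clebsch-Gordan coefficients. For $j\in\{|j_1-j_2|,\dots,j_1+j_2\}$ and $m\in\{-j,\dots,j\}$ let $$P^j_{mj}=\sqrt{\frac{[j+m]_q!}{[2j]_q!\,[j-m]_q!}}\sum_{r\ge0}\frac{(-1)^r[2j+1]_q!}{[r]_q!\,[2j+r+1]_q!}\,J_-(12)^{\,r+j-m}J_+(12)^{\,r}$$ (a finite sum, since $J_+(12)$ is nilpotent), and let $|j_1,j_2:jm\rangle$ be the unit vector $P^j_{mj}|j_1j_1\rangle|j_2\,j-j_1\rangle/\|P^j_{mj}|j_1j_1\rangle|j_2\,j-j_1\rangle\|$.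 For $m=m_1+m_2$, $\langle j_1m_1,j_2m_2|jm\rangle_q$ denotes the coefficient of $|j_1m_1\rangle|j_2m_2\rangle$ in $|j_1,j_2:jm\rangle$. $q$-Hahn polynomials. Let $N$ be a positive integer, $\alpha,\beta>-1$ (integers in this application), $x(s)=\frac{q^{2s}-1}{q^2-1}$, $s\in\{0,\dots,N-1\}$, $n\in\{0,\dots,N-1\}$. Define $$h_n^{\alpha,\beta}(x(s),N)_q=(-1)^nq^{\frac n2\left(\alpha+\beta+\frac{n+1}2\right)}(\beta+1|q)_n\frac{[N-1]_q!}{[n]_q!\,[N-1-n]_q!}\sum_{k=0}^{\min(n,s)}\frac{(-n|q)_k(-s|q)_k(\alpha+\beta+n+1|q)_k}{(\beta+1|q)_k(1-N|q)_k}\frac{q^{k(s-N-\alpha)}}{[k]_q!}.$$ The weight is $$\rho(s)=q^{(\alpha+\beta)s}\,\frac{[s+\beta]_q!\,[N+\alpha-s-1]_q!}{[s]_q!\,[N-s-1]_q!},$$ and the squared norm is $d_n^2=\sum_{s=0}^{N-1}h_n^{\alpha,\beta}(x(s),N)_q^2\,\rho(s)\,\bigl(x(s+\tfrac12)-x(s-\tfrac12)\bigr)$. *)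

(* Defs.v *)
From mathcomp Require Import all_boot all_order all_algebra.
From mathcomp Require Import complex mxtens.
From mathcomp Require Import reals exp.

Set Implicit Arguments.
Unset Strict Implicit.
Unset Printing Implicit Defensive.

Import Order.TTheory GRing.Theory Num.Theory.

Local Open Scope ring_scope.
Local Open Scope complex_scope.

(* Spins and weights are real numbers.  Combinations such as j - m or 2 * j,
   which are natural numbers for admissible spins and weights, are converted
   to nat by [Num.truncn]; the conversion is then exact. *)

(* j \in {0, 1/2, 1, 3/2, ...} *)
Definition is_spin (R : realType) (j : R) : Prop :=
  exists d : nat, j = d%:R / 2.

(* x \in {a, a + 1, ..., b} *)
Definition unit_steps (R : realType) (a b x : R) : Prop :=
  exists2 k : nat, x = a + k%:R & x <= b.

Definition qnum (R : realType) (q x : R) : R :=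
  (q `^ x - q `^ (- x)) / (q - q^-1).

Definition qfact (R : realType) (q : R) (n : nat) : R :=
  \prod_(i < n) qnum q i.+1%:R.

(* (a|q)_k *)
Definition qpoch (R : realType) (q a : R) (k : nat) : R :=
  \prod_(i < k) qnum q (a + i%:R).

Section Representation.
Context {R : realType}.
Implicit Types (q j m a : R).

(* 2j + 1 *)
Definition dim_spin j : nat := (Num.truncn (2 * j)).+1.

(* The i-th basis vector of D^j is |j, -j + i>; operators are matrices acting
   on column vectors from the left. *)
Definition wt j (i : 'I_(dim_spin j)) : R := - j + i%:R.

Definition ket j m : 'cV[R[i]]_(dim_spin j) :=
  \col_i (wt i == m)%:R.

Definition Jminus q j : 'M[R[i]]_(dim_spin j) :=
  \matrix_(i, k) if wt i == wt k - 1
    then (Num.sqrt (qnum q (j + wt k) * qnum q (j - wt k + 1)))%:C else 0.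

Definition Jplus q j : 'M[R[i]]_(dim_spin j) :=
  \matrix_(i, k) if wt i == wt k + 1
    then (Num.sqrt (qnum q (j - wt k) * qnum q (j + wt k + 1)))%:C else 0.

(* q^{a J_0} *)
Definition qJ0 q a j : 'M[R[i]]_(dim_spin j) :=
  diag_mx (\row_i (q `^ (a * wt i))%:C).

Definition Jminus12 q j1 j2 : 'M[R[i]]_(dim_spin j1 * dim_spin j2) :=
  Jminus q j1 *t qJ0 q 1 j2 + qJ0 q (-1) j1 *t Jminus q j2.

Definition Jplus12 q j1 j2 : 'M[R[i]]_(dim_spin j1 * dim_spin j2) :=
  Jplus q j1 *t qJ0 q 1 j2 + qJ0 q (-1) j1 *t Jplus q j2.

(* |j1 m1>|j2 m2>, with the Kronecker product *t as tensor product;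
   the single column index has type 'I_(1 * 1) = 'I_1. *)
Definition ket12 j1 j2 m1 m2 : 'cV[R[i]]_(dim_spin j1 * dim_spin j2) :=
  ket j1 m1 *t ket j2 m2.

Definition inner (n : nat) (u v : 'cV[R[i]]_n) : R[i] :=
  \sum_i (u i 0)^* * v i 0.

Definition vnorm (n : nat) (u : 'cV[R[i]]_n) : R[i] := sqrtC (inner u u).

(* P^j_{mj} on D^{j1} (x) D^{j2}.  The sum over all r >= 0 stops at
   r = 2 j1 + 2 j2 + 1: J_+(12) raises m1 + m2 by 1 and
   |m1 + m2| <= j1 + j2, so all further powers of J_+(12) vanish. *)
Definition projP q j1 j2 j m : 'M[R[i]]_(dim_spin j1 * dim_spin j2) :=
  let d := Num.truncn (2 * j) in
  (Num.sqrt (qfact q (Num.truncn (j + m)) /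
             (qfact q d * qfact q (Num.truncn (j - m)))))%:C *:
  \sum_(r < dim_spin j1 + dim_spin j2)
    ((-1) ^+ r * qfact q d.+1 / (qfact q r * qfact q (d + r).+1))%:C *:
    (Jminus12 q j1 j2 ^+ (r + Num.truncn (j - m)) * Jplus12 q j1 j2 ^+ r).

(* |j1, j2 : j m> *)
Definition coupled q j1 j2 j m : 'cV[R[i]]_(dim_spin j1 * dim_spin j2) :=
  let v := projP q j1 j2 j m *m ket12 j1 j2 j1 (j - j1) in
  (vnorm v)^-1 *: v.

(* <j1 m1, j2 m2 | j m>_q, read off in the orthonormal basis |j1 m1>|j2 m2> *)
Definition clebsch_gordan q j1 m1 j2 m2 j m : R[i] :=
  inner (ket12 j1 j2 m1 m2) (coupled q j1 j2 j m).

End Representation.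

Section QHahn.
Context {R : realType}.
Implicit Types (q alpha beta : R) (N n s : nat).

Definition lattice q (s : R) : R := (q `^ (2 * s) - 1) / (q ^+ 2 - 1).

(* h_n^{alpha,beta}(x(s), N)_q as a function of s *)
Definition qhahn q alpha beta N n s : R :=
  (-1) ^+ n * q `^ (n%:R / 2 * (alpha + beta + (n%:R + 1) / 2)) *
  qpoch q (beta + 1) n *
  (qfact q N.-1 / (qfact q n * qfact q (N.-1 - n)%N)) *
  \sum_(k < (minn n s).+1)
    (qpoch q (- n%:R) k * qpoch q (- s%:R) k *
     qpoch q (alpha + beta + n%:R + 1) k) /
    (qpoch q (beta + 1) k * qpoch q (1 - N%:R) k) *
    (q `^ (k%:R * (s%:R - N%:R - alpha)) / qfact q k).

(* For integers alpha, beta > -1 and s < N. *)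
Definition qhahn_weight q alpha beta N s : R :=
  q `^ ((alpha + beta) * s%:R) *
  (qfact q (Num.truncn (s%:R + beta)) *
   qfact q (Num.truncn (N%:R + alpha - s%:R - 1))) /
  (qfact q s * qfact q (N - s - 1)%N).

(* x(s + 1/2) - x(s - 1/2) *)
Definition lattice_step q s : R :=
  lattice q (s%:R + 1 / 2) - lattice q (s%:R - 1 / 2).

(* d_n^2 *)
Definition qhahn_sqnorm q alpha beta N n : R :=
  \sum_(s < N) qhahn q alpha beta N n s ^+ 2 *
    qhahn_weight q alpha beta N s * lattice_step q s.

End QHahn.

(* Main.v *)
Require Import Defs.
From mathcomp Require Import all_boot all_order all_algebra.
From mathcomp Require Import complex mxtens.
From mathcomp Require Import reals exp.
From mathcomp Require Import boolp.
From mathcomp Require Import ring lra zify.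

Set Implicit Arguments.
Unset Strict Implicit.
Unset Printing Implicit Defensive.

Import Order.TTheory GRing.Theory Num.Theory.
Local Open Scope ring_scope.
Local Open Scope complex_scope.

(* In the basis rescaled by sqrt ([x]! [y]! / ([2 j1 - x]! [2 j2 - y]!)), where
   x = j1 + m1 and y = j2 + m2, the operators J_-(12) and J_+(12) become
   two-term difference operators without square roots, and the square of the
   scaling factor is the q-Hahn weight up to a power of q.  From
   J_+ J_- - J_- J_+ = [2 J_0] the sum over r in P^j_{mj} telescopes under J_+,
   so P^j_{jj} |j1 j1>|j2 j-j1> is a highest weight vector u.  The equation
   J_+ u = 0 is a first-order recurrence, hence u has the coefficients
   c (-1)^(j1 - m1) q^((j + 1) s) with s = j2 - m2, and c > 0 because u - |j1 j1>|j2 j-j1> is in the image of J_-, which is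
   orthogonal to ker J_+.  Applying J_- to the coefficients is the backward
   shift of the q-Hahn polynomials, (alpha, beta, N, n) to
   (alpha - 1, beta - 1, N + 1, n + 1).  Therefore (-1)^(j1 - m1) times the
   coefficients of J_-^n u is a positive multiple of the q-Hahn polynomial, and
   the normalisation fixes the factor. *)

(** * Elementary facts on q-numbers, q-factorials and q-Pochhammer symbols *)

Section QNumbers.
Context {R : realType}.
Implicit Types (q x y z : R).

Lemma powR_D q x y : 0 < q -> q `^ (x + y) = q `^ x * q `^ y.
Proof. by move=> q0; rewrite powRD // (gt_eqF q0) implybT. Qed.

Lemma powR_neq0 q x : 0 < q -> q `^ x != 0.
Proof. by move=> q0; rewrite gt_eqF // powR_gt0. Qed.

Lemma qden_neq0 q : 0 < q < 1 -> q ^+ 2 - 1 != 0.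
Proof.
move=> /andP[q0 q1]; rewrite subr_eq0; apply/negP => /eqP h; nra.
Qed.

Lemma qnumE q x : 0 < q ->
  qnum q x = (q `^ x - (q `^ x)^-1) / (q - q^-1).
Proof. by rewrite /qnum powRN. Qed.

Lemma qnum0 q : qnum q 0 = 0.
Proof. by rewrite /qnum oppr0 subrr mul0r. Qed.

Lemma qnum1 q : 0 < q < 1 -> qnum q 1 = 1.
Proof.
move=> q01; have := qden_neq0 q01; case/andP: q01 => q0 _ h.
rewrite qnumE // powRr1 ?(ltW q0) // divff //; apply: contra h => /eqP h.
have -> : q ^+ 2 - 1 = q * (q - q^-1).
  by rewrite mulrBr -expr2 divff // gt_eqF.
by rewrite h mulr0.
Qed.

Lemma qnumN q x : qnum q (- x) = - qnum q x.
Proof. by rewrite /qnum opprK -mulNr opprB. Qed.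

Lemma qnum_gt0 q x : 0 < q < 1 -> 0 < x -> 0 < qnum q x.
Proof.
move=> /andP[q0 q1] x0; rewrite qnumE //.
have hq : q - q^-1 < 0 by rewrite subr_lt0 (lt_trans q1) // invf_gt1.
rewrite nmulr_lgt0 ?invr_lt0 // subr_lt0.
have h1 : q `^ x < 1.
  have := @gt0_ltr_powR R x x0 q 1; rewrite powR1; by apply; rewrite ?nnegrE ?ltW.
by rewrite (lt_trans h1) // invf_gt1 // powR_gt0.
Qed.

Lemma qnum_neq0 q x : 0 < q < 1 -> x != 0 -> qnum q x != 0.
Proof.
move=> q01; case: ltgtP => // x0 _; last by rewrite gt_eqF // qnum_gt0.
by rewrite -oppr_eq0 -qnumN gt_eqF // qnum_gt0 // oppr_gt0.
Qed.

Lemma qfactS q n : qfact q n.+1 = qfact q n * qnum q n.+1%:R.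
Proof. by rewrite /qfact big_ord_recr. Qed.

Lemma qpochS q x n : qpoch q x n.+1 = qpoch q x n * qnum q (x + n%:R).
Proof. by rewrite /qpoch big_ord_recr. Qed.

Lemma qfact_gt0 q n : 0 < q < 1 -> 0 < qfact q n.
Proof. by move=> q01; apply: prodr_gt0 => i _; apply: qnum_gt0. Qed.

Lemma qpoch_gt0 q x n : 0 < q < 1 -> 0 < x -> 0 < qpoch q x n.
Proof.
by move=> q01 x0; apply: prodr_gt0 => i _; apply: qnum_gt0; rewrite // ltr_pwDl.
Qed.

Lemma qpochN_eq0 q n k : (n < k)%N -> qpoch q (- n%:R) k = 0.
Proof.
by move=> nk; apply/eqP/prodf_eq0; exists (Ordinal nk); rewrite //= addNr qnum0.
Qed.

(** Both sides are the product of the k + 1 consecutive q-numbers from [x] to [x+k]. *)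
Lemma qpoch_shift q x k :
  qnum q x * qpoch q (x + 1) k = qpoch q x k * qnum q (x + k%:R).
Proof.
rewrite -qpochS /qpoch big_ord_recl addr0; congr (_ * _).
by apply: eq_bigr => i _; rewrite -addrA lift0 nat1r.
Qed.

End QNumbers.

(** * The ladder operators in the rescaled basis and their commutator *)

Section GaugedOperators.
Context {R : realType}.
Implicit Types (q : R) (f g : nat -> nat -> R).

(* J_-(12) and J_+(12) on coefficient functions in the rescaled basis of [gvec];
   x = j1 + m1 and y = j2 + m2. *)
Definition low q (j1 j2 : R) f (x y : nat) : R :=
  qnum q x.+1%:R * qnum q (2 * j1 - x%:R) * q `^ (y%:R - j2) * f x.+1 y +
  qnum q y.+1%:R * qnum q (2 * j2 - y%:R) * q `^ (j1 - x%:R) * f x y.+1.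

Definition rise q (j1 j2 : R) f (x y : nat) : R :=
  q `^ (y%:R - j2) * (if x is x'.+1 then f x' y else 0) +
  q `^ (j1 - x%:R) * (if y is y'.+1 then f x y' else 0).

(** This is J_+ J_- - J_- J_+ = [2 J_0], since x + y - j1 - j2 = m1 + m2. At x = 0 or y = 0 the
    terms left out of [rise] either cancel between both sides or carry the factor [0]. *)
Lemma rise_low q j1 j2 f x y : 0 < q < 1 ->
  rise q j1 j2 (low q j1 j2 f) x y =
  low q j1 j2 (rise q j1 j2 f) x y +
  qnum q (2 * (x%:R + y%:R - j1 - j2)) * f x y.
Proof.
move=> q01; have q0 : 0 < q by case/andP: q01.
have h1 := qden_neq0 q01; have h2 : q != 0 by rewrite gt_eqF.
have hx z := powR_neq0 z q0.
have q1 : q `^ 1 = q by rewrite powRr1 // ltW.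
case: x => [|x]; case: y => [|y]; rewrite /low /rise /= ?mulr2n ?mulrDl ?mul1r;
 rewrite ?qnumE // -?natr1 ?(powR_D, powRN) ?q1 ?powRr0 //;
 field; rewrite ?hx ?h2 ?h1 //.
Qed.

End GaugedOperators.

(** * The extremal projector and its telescoping under J_+ *)

Section ExtremalProjector.
Context {R : realType}.
Implicit Types (q w : R) (f g : nat -> nat -> R).

(** Here w is the J_0(12) weight shifted by j1 + j2. It is real, so that lowering subtracts 1
    without truncation. *)
Definition of_weight w f := forall x y : nat, x%:R + y%:R != w -> f x y = 0.

Lemma low_of_weight q j1 j2 w f :
  of_weight w f -> of_weight (w - 1) (low q j1 j2 f).
Proof.
move=> fw x y; rewrite eq_sym subr_eq eq_sym => xy.
by rewrite /low !fw ?mulr0 ?addr0 // -natr1 ?addrA // addrAC.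
Qed.

Lemma rise_of_weight q j1 j2 w f :
  of_weight w f -> of_weight (w + 1) (rise q j1 j2 f).
Proof.
move=> fw x y xy; rewrite /rise.
have -> : (if x is x'.+1 then f x' y else 0) = 0.
  case: x xy => // x xy; apply: fw; apply: contra xy => /eqP <-.
  by rewrite -natr1 addrAC.
have -> : (if y is y'.+1 then f x y' else 0) = 0.
  case: y xy => // y xy; apply: fw; apply: contra xy => /eqP <-.
  by rewrite -natr1 addrA.
by rewrite !mulr0 addr0.
Qed.

Lemma iter_low_of_weight q j1 j2 k w f :
  of_weight w f -> of_weight (w - k%:R) (iter k (low q j1 j2) f).
Proof.
move=> fw; elim: k => [|k IH]; first by rewrite subr0.
by rewrite -natr1 opprD addrA; exact: low_of_weight.
Qed.

Lemma iter_rise_of_weight q j1 j2 k w f :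
  of_weight w f -> of_weight (w + k%:R) (iter k (rise q j1 j2) f).
Proof.
move=> fw; elim: k => [|k IH]; first by rewrite addr0.
by rewrite -natr1 addrA; exact: rise_of_weight.
Qed.

Lemma low_sum q j1 j2 n (c : nat -> R) (F : nat -> nat -> nat -> R) :
  low q j1 j2 (fun x y => \sum_(i < n) c i * F i x y) =
  fun x y => \sum_(i < n) c i * low q j1 j2 (F i) x y.
Proof.
apply/funext => x; apply/funext => y; rewrite /low !mulr_sumr -big_split.
by apply: eq_bigr => i _ /=; ring.
Qed.

Lemma iter_low_sum q j1 j2 k n (c : nat -> R) (F : nat -> nat -> nat -> R) :
  iter k (low q j1 j2) (fun x y => \sum_(i < n) c i * F i x y) =
  fun x y => \sum_(i < n) c i * iter k (low q j1 j2) (F i) x y.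
Proof. elim: k => //= k ->.
by rewrite (low_sum _ _ _ _ c (fun i => iter k (low q j1 j2) (F i))).
Qed.

Lemma lowD q j1 j2 (c : R) f g x y :
  low q j1 j2 (fun x y => f x y + c * g x y) x y =
  low q j1 j2 f x y + c * low q j1 j2 g x y.
Proof. rewrite /low; ring. Qed.

Lemma rise_sum q j1 j2 n (c : nat -> R) (F : nat -> nat -> nat -> R) x y :
  rise q j1 j2 (fun x y => \sum_(i < n) c i * F i x y) x y =
  \sum_(i < n) c i * rise q j1 j2 (F i) x y.
Proof.
rewrite /rise.
under [RHS]eq_bigr do rewrite mulrDr mulrCA (mulrCA (c _) (q `^ (j1 - _))).
rewrite big_split /= -!mulr_sumr; congr (_ * _ + _ * _).
  by case: x => //; rewrite big1 // => i _; rewrite mulr0.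
by case: y => //; rewrite big1 // => i _; rewrite mulr0.
Qed.

(** Moving J_+ past each J_- adds a scalar [2 m'], m' being the weight reached; these q-numbers add
    up to [k+1] [2m-k] with m = w - j1 - j2. *)
Lemma rise_iter_low q j1 j2 k w f x y : 0 < q < 1 -> of_weight w f ->
  rise q j1 j2 (iter k.+1 (low q j1 j2) f) x y =
  iter k.+1 (low q j1 j2) (rise q j1 j2 f) x y +
  qnum q k.+1%:R * qnum q (2 * (w - j1 - j2) - k%:R) *
  iter k (low q j1 j2) f x y.
Proof.
move=> q01; have q0 : 0 < q by case/andP: q01.
have h1 := qden_neq0 q01; have h2 : q != 0 by rewrite gt_eqF.
have hx z := powR_neq0 z q0.
have q1 : q `^ 1 = q by rewrite powRr1 // ltW.
move=> fw; elim: k x y => [|k IH] x y.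
  rewrite rise_low //=; congr (_ + _).
  have -> : qnum q 1 = 1 by exact: qnum1.
  rewrite mul1r subr0.
  case: (eqVneq (x%:R + y%:R) w) => [<- //|xy].
  by rewrite (fw _ _ xy) !mulr0.
rewrite [X in rise _ _ _ X]iterS rise_low // !iterS.
have -> : rise q j1 j2 (iter k.+1 (low q j1 j2) f) = fun x y =>
   iter k.+1 (low q j1 j2) (rise q j1 j2 f) x y +
   qnum q k.+1%:R * qnum q (2 * (w - j1 - j2) - k%:R) *
   iter k (low q j1 j2) f x y.
  by apply/funext => x'; apply/funext => y'; rewrite IH.
rewrite lowD -[LHS]addrA; congr (_ + _).
set F := iter k _ f.
(* Off this antidiagonal the remaining terms vanish. On it they are multiples of one value, and with
   u = 2 (w - j1 - j2) the identity [k+1] [u-k] + [u-2k-2] = [k+2] [u-k-1] is left. *)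
case: (eqVneq (x%:R + y%:R) (w - k.+1%:R)) => [->|xy]; last first.
  have F0 : iter k.+1 (low q j1 j2) f x y = 0.
    exact: iter_low_of_weight fw _ _ xy.
  by rewrite /F -iterS F0 !mulr0 addr0.
rewrite -mulrDl; congr (_ * _).
rewrite ?mulr2n ?mulrDl ?mul1r;
 rewrite ?qnumE // -?natr1 ?(powR_D, powRN) ?q1 ?powRr0 //;
 field; rewrite ?hx ?h2 ?h1 //.
Qed.

(** The coefficient of the r-th term of P^j_{mj}, with d = 2j. *)
Definition projC q d r : R :=
  (-1) ^+ r * qfact q d.+1 / (qfact q r * qfact q (d + r).+1).

(** The commutator part of term r + 1 cancels what term r leaves, because [projC] at r + 1 times
    [r+1] [d+r+2] is minus [projC] at r. Only the remainder of the last term survives. *)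
Lemma rise_extremal q j1 j2 d n w f x y : 0 < q < 1 -> of_weight w f ->
  2 * (w - j1 - j2) = d%:R ->
  rise q j1 j2 (fun x y => \sum_(r < n.+1) projC q d r *
     iter r (low q j1 j2) (iter r (rise q j1 j2) f) x y) x y =
  projC q d n * iter n (low q j1 j2) (iter n.+1 (rise q j1 j2) f) x y.
Proof.
move=> q01 fw hd.
rewrite (rise_sum _ _ _ _ (projC q d)
  (fun r => iter r (low q j1 j2) (iter r (rise q j1 j2) f))).
elim: n => [|n IH]; first by rewrite big_ord_recl big_ord0 addr0.
rewrite big_ord_recr /= IH.
rewrite (rise_iter_low _ _ _ _ _ q01 (@iter_rise_of_weight q j1 j2 n.+1 _ _ fw)).
have -> : 2 * (w + n.+1%:R - j1 - j2) - n%:R = (d + n.+1).+1%:R.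
  by rewrite -(natr1 (d + _)) natrD -hd -natr1; ring.
rewrite mulrDr addrC -addrA [X in _ + X](_ : _ = 0) ?addr0 // mulrA -mulrDl.
rewrite [X in X * _](_ : _ = 0) ?mul0r // /projC exprS addnS !qfactS.
have h k := lt0r_neq0 (qfact_gt0 k q01).
have h' (k : nat) : qnum q k.+1%:R != 0 by apply: qnum_neq0; rewrite ?pnatr_eq0.
by field; rewrite ?h ?h'.
Qed.

End ExtremalProjector.

(** * The backward shift of the q-Hahn sums *)

Section BackwardShift.
Context {R : realType}.
Implicit Types (q al be s g : R) (M n k : nat).

(** Each term of the q-Hahn sum is split into a coefficient free of s and the function [hahn_basis]
    of s, so that operators in s act on the latter only. *)
Definition hahn_coef q al be M n k : R :=
  qpoch q (- n%:R) k * qpoch q (al + be + n%:R + 1) k /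
  (qpoch q (be + 1) k * qpoch q (- M%:R) k * qfact q k) *
  q `^ (- (k%:R * (M%:R + 1 + al))).

Definition hahn_basis q k s : R := qpoch q (- s) k * q `^ (k%:R * s).

(* The sum in [qhahn], with N = M + 1 and s a real argument. *)
Definition hahn_sum q al be M n s : R :=
  \sum_(k < n.+1) hahn_coef q al be M n k * hahn_basis q k s.

(** The backward shift operator is bidiagonal in [hahn_basis]; [hahn_diag] and [hahn_next] are its
    entries. *)
Definition hahn_diag q al be M k : R :=
  - (q `^ ((al + be) / 2) * qnum q (be + k%:R) * qnum q (M%:R + 1 - k%:R)).
Definition hahn_next q al be M k : R :=
  - (q `^ ((be - al) / 2 - M%:R - 1) * qnum q (al + be + k%:R)).

(** Since [s] (-(s-1)|q)_k = (-s|q)_k [s-k], both terms on the left contain (-s|q)_k, and the rest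
    is an identity between powers of q. *)
Lemma hahn_basis_shift q al be M k s : 0 < q < 1 ->
  q `^ (- ((al + be) / 2)) * qnum q (M%:R + al + 1 - s) * qnum q s *
    hahn_basis q k (s - 1) -
  q `^ ((al + be) / 2) * qnum q (be + s) * qnum q (M%:R + 1 - s) *
    hahn_basis q k s =
  hahn_diag q al be M k * hahn_basis q k s +
  hahn_next q al be M k * hahn_basis q k.+1 s.
Proof.
move=> q01; have q0 : 0 < q by case/andP: q01.
have h1 := qden_neq0 q01; have h2 : q != 0 by rewrite gt_eqF.
have hx z := powR_neq0 z q0.
have q1 : q `^ 1 = q by rewrite powRr1 // ltW.
(* With the half sum [g] as a variable all exponents become integral combinations of atoms, which
   [field] can compare as monomials. *)
pose g := (al + be) / 2.
have alE : al = g + g - be by rewrite /g; field.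
have beE : (be - al) / 2 = be - g by rewrite /g; field.
rewrite /hahn_diag /hahn_next /hahn_basis beE -/g alE.
have sh : qnum q s * qpoch q (- (s - 1)) k =
    - (qpoch q (- s) k * qnum q (k%:R - s)).
  rewrite -[in qnum q s](opprK s) qnumN mulNr opprB (addrC 1).
  by rewrite qpoch_shift (addrC k%:R).
rewrite [X in X - _](_ : _ = q `^ (- g) * qnum q (M%:R + (g + g - be) + 1 - s) *
  (qnum q s * qpoch q (- (s - 1)) k) * q `^ (k%:R * (s - 1))); last by ring.
rewrite sh qpochS -(natr1 k) !(mulrDl, mulrDr, mulrN, mulr1, mul1r, mulrN1).
move: (qpoch q (- s) k) => P.
rewrite ?qnumE // !(powR_D, powRN) ?q1 //; field; rewrite ?hx ?h2 ?h1 //.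
Qed.

Lemma hahn_coef0 q al be M n : hahn_coef q al be M n 0 = 1.
Proof.
by rewrite /hahn_coef /qpoch /qfact !big_ord0 mul0r oppr0 powRr0 !(mulr1, invr1).
Qed.

Lemma hahn_coefS q al be M n k : 0 < q ->
  hahn_coef q al be M n k.+1 = hahn_coef q al be M n k *
  (qnum q (k%:R - n%:R) * qnum q (al + be + n%:R + 1 + k%:R) /
   (qnum q (be + 1 + k%:R) * qnum q (k%:R - M%:R) * qnum q k.+1%:R)) *
  q `^ (- (M%:R + 1 + al)).
Proof.
move=> q0; rewrite /hahn_coef !qpochS qfactS ![- _ + k%:R]addrC !invfM.
have -> : - (k.+1%:R * (M%:R + 1 + al)) =
  - (k%:R * (M%:R + 1 + al)) - (M%:R + 1 + al) by rewrite -natr1; ring.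
rewrite (powR_D (- (k%:R * _))) //; ring.
Qed.

Lemma qpoch_recl q x k : qpoch q x k.+1 = qnum q x * qpoch q (x + 1) k.
Proof. by rewrite qpoch_shift qpochS. Qed.

(** Under the parameter shift each Pochhammer symbol of length k + 1 is its first factor times the
    old symbol of length k. *)
Lemma hahn_coef_shift q al be M n k : 0 < q ->
  hahn_coef q (al - 1) (be - 1) M.+1 n.+1 k.+1 = hahn_coef q al be M n k *
  (qnum q n.+1%:R * qnum q (al + be + n%:R) /
   (qnum q be * qnum q M.+1%:R * qnum q k.+1%:R)) * q `^ (- (M%:R + 1 + al)).
Proof.
move=> q0; rewrite /hahn_coef !qpoch_recl qfactS !qnumN -natr1.
have -> : - (n%:R + 1) + 1 = - n%:R :> R by ring.
rewrite -(natr1 M); have -> : - (M%:R + 1) + 1 = - M%:R :> R by ring.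
have -> : al - 1 + (be - 1) + (n%:R + 1) + 1 = al + be + n%:R by ring.
have -> : be - 1 + 1 = be by ring.
have -> : - (k.+1%:R * (M%:R + 1 + 1 + (al - 1))) =
  - (k%:R * (M%:R + 1 + al)) - (M%:R + 1 + al) by rewrite -(natr1 k); ring.
rewrite (powR_D (- (k%:R * _))) //.
move: (qnum q be) (qnum q (M%:R + 1)) (qnum q k.+1%:R) => A B C.
by rewrite !invfM invrN; ring.
Qed.

(* The bound k < n <= M keeps the factor [k - M]_q of the denominator of
   [hahn_coef] nonzero. *)
Lemma hahn_coef_rec q al be M n k : 0 < q < 1 -> 0 < be -> (n <= M)%N ->
  (k < n)%N ->
  hahn_coef q al be M n k.+1 * hahn_diag q al be M k.+1 +
    hahn_coef q al be M n k * hahn_next q al be M k =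
  hahn_diag q al be M 0 * hahn_coef q (al - 1) (be - 1) M.+1 n.+1 k.+1.
Proof.
move=> q01 be0 nM kn; have q0 : 0 < q by case/andP: q01.
have h1 := qden_neq0 q01; have h2 : q != 0 by rewrite gt_eqF.
have hx z := powR_neq0 z q0.
have q1 : q `^ 1 = q by rewrite powRr1 // ltW.
rewrite hahn_coefS // hahn_coef_shift // /hahn_diag /hahn_next subr0 addr0.
have n1 : qnum q be != 0 by rewrite gt_eqF // qnum_gt0.
have n2 : qnum q (be + 1 + k%:R) != 0.
  by rewrite gt_eqF // qnum_gt0 // ltr_pwDl // addr_gt0.
have n3 : qnum q (k%:R - M%:R) != 0.
  by rewrite qnum_neq0 // subr_eq0 eqr_nat; lia.
have n4 (i : nat) : qnum q i.+1%:R != 0 by rewrite qnum_neq0 ?pnatr_eq0.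
have -> : M%:R + 1 - k.+1%:R = - (k%:R - M%:R) :> R by rewrite -natr1; ring.
have -> : be + k.+1%:R = be + 1 + k%:R by rewrite -natr1; ring.
rewrite qnumN (_ : qnum q (M%:R + 1) = qnum q M.+1%:R) ; last by rewrite natr1.
pose g := (al + be) / 2.
have -> : (be - al) / 2 - M%:R - 1 = g - (M%:R + 1 + al) by rewrite /g; field.
rewrite -/g [q `^ (g - _)]powR_D // !powRN.
(* Once the common factors are cancelled, the recurrence is this identity between q-numbers. *)
have key : qnum q (k%:R - n%:R) * qnum q (al + be + n%:R + 1 + k%:R) -
    qnum q k.+1%:R * qnum q (al + be + k%:R) =
    - (qnum q n.+1%:R * qnum q (al + be + n%:R)).
  by rewrite ?qnumE // -!natr1 !(powR_D, powRN) ?q1 //; field; rewrite ?hx ?h2 ?h1.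
move/eqP: key; rewrite subr_eq addrC => /eqP key.
move: (hx (M%:R + 1 + al)) => hM.
rewrite key; field; rewrite ?n1 ?n2 ?n3 ?n4 ?hM //.
Qed.

(** The sum for n ends at k = n, so the top basis function arises from [hahn_next] alone. *)
Lemma hahn_coef_rec_last q al be M n : 0 < q < 1 -> 0 < be ->
  hahn_coef q al be M n n * hahn_next q al be M n =
  hahn_diag q al be M 0 * hahn_coef q (al - 1) (be - 1) M.+1 n.+1 n.+1.
Proof.
move=> q01 be0; have q0 : 0 < q by case/andP: q01.
have hx z := powR_neq0 z q0.
rewrite hahn_coef_shift // /hahn_diag /hahn_next subr0 addr0.
have n1 : qnum q be != 0 by rewrite gt_eqF // qnum_gt0.
have n4 (i : nat) : qnum q i.+1%:R != 0 by rewrite qnum_neq0 ?pnatr_eq0.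
pose g := (al + be) / 2.
have -> : (be - al) / 2 - M%:R - 1 = g - (M%:R + 1 + al) by rewrite /g; field.
rewrite -/g [q `^ (g - _)]powR_D // powRN.
rewrite (_ : qnum q (M%:R + 1) = qnum q M.+1%:R); last by rewrite natr1.
by field; rewrite ?n1 ?n4 ?hx.
Qed.

(** Coefficients in [hahn_basis] are compared: the lowest by [hahn_coef0], the middle ones by
    [hahn_coef_rec], the top one by [hahn_coef_rec_last]. *)
Lemma hahn_sum_backward q al be M n s : 0 < q < 1 -> 0 < be -> (n <= M)%N ->
  q `^ (- ((al + be) / 2)) * qnum q (M%:R + al + 1 - s) * qnum q s *
    hahn_sum q al be M n (s - 1) -
  q `^ ((al + be) / 2) * qnum q (be + s) * qnum q (M%:R + 1 - s) *
    hahn_sum q al be M n s =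
  - (q `^ ((al + be) / 2) * qnum q be * qnum q M.+1%:R) *
  hahn_sum q (al - 1) (be - 1) M.+1 n.+1 s.
Proof.
move=> q01 be0 nM; have q0 : 0 < q by case/andP: q01.
have -> : - (q `^ ((al + be) / 2) * qnum q be * qnum q M.+1%:R) =
    hahn_diag q al be M 0.
  by rewrite /hahn_diag addr0 subr0 natr1.
have rhs : hahn_sum q (al - 1) (be - 1) M.+1 n.+1 s = hahn_basis q 0 s +
    (\sum_(k < n) hahn_coef q (al - 1) (be - 1) M.+1 n.+1 k.+1 *
       hahn_basis q k.+1 s +
     hahn_coef q (al - 1) (be - 1) M.+1 n.+1 n.+1 * hahn_basis q n.+1 s).
  by rewrite /hahn_sum big_ord_recl big_ord_recr /= hahn_coef0 mul1r.
rewrite {}rhs /hahn_sum [X in X - _]mulr_sumr [X in _ - X]mulr_sumr -sumrB.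
transitivity (\sum_(k < n.+1)
   (hahn_coef q al be M n k * hahn_diag q al be M k * hahn_basis q k s +
    hahn_coef q al be M n k * hahn_next q al be M k * hahn_basis q k.+1 s)).
  apply: eq_bigr => k _.
  rewrite [RHS](_ : _ = hahn_coef q al be M n k * (hahn_diag q al be M k *
    hahn_basis q k s + hahn_next q al be M k * hahn_basis q k.+1 s)); last by ring.
  by rewrite -hahn_basis_shift //; ring.
rewrite !mulrDr [_ * (_ * hahn_basis q n.+1 s)]mulrA -hahn_coef_rec_last //.
rewrite big_split /=.
rewrite big_ord_recl [X in _ + X]big_ord_recr /= hahn_coef0 mul1r -!addrA.
congr (_ + _); rewrite !addrA; congr (_ + _).
rewrite -big_split /= mulr_sumr; apply: eq_bigr => k _.
by rewrite -mulrDl hahn_coef_rec // -mulrA.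
Qed.

End BackwardShift.

(** * The q-Hahn form of lowered highest weight vectors *)

Section LoweredHighestWeight.
Context {R : realType}.
Implicit Types (q : R) (a b M n s t : nat).

(* The coefficient at x = b + s, y = M + a - s; the sign is that of
   (-1)^(j1 - m1) h_n, the prefactor of h_n having the sign (-1)^n. *)
Definition hahn_vec q a b M n s : R :=
  (-1) ^+ (n + M + s) * q `^ ((a%:R + b%:R + 2) / 2 * s%:R) *
  hahn_sum q a%:R b%:R M n s%:R.

Lemma hahn_vec0 q a b M s : hahn_vec q a b M 0 s =
  (-1) ^+ (M + s) * q `^ ((a%:R + b%:R + 2) / 2 * s%:R).
Proof.
rewrite /hahn_vec /hahn_sum big_ord_recl big_ord0 hahn_coef0 /hahn_basis.
by rewrite /qpoch big_ord0 mul0r powRr0 !mulr1 addr0 mulr1.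
Qed.

(** The two neighbours used by J_- are the points t = s and t = s - 1 of the next higher
    antidiagonal, so J_- acts as the backward shift in s. *)
Lemma low_hahn_vec q a b M n (c : R) (f : nat -> nat -> R) s :
  0 < q < 1 -> (n <= M)%N -> (s <= M.+1)%N ->
  (forall t, (t <= M)%N -> f (b.+1 + t)%N (M + a.+1 - t)%N =
     c * hahn_vec q a.+1 b.+1 M n t) ->
  low q ((M + b).+1%:R / 2) ((M + a).+1%:R / 2) f (b + s)%N (M.+1 + a - s)%N =
  c * (q `^ ((M + a).+1%:R / 2) * qnum q b.+1%:R * qnum q M.+1%:R) *
  hahn_vec q a b M.+1 n.+1 s.
Proof.
move=> q01 nM sM hf; have q0 : 0 < q by case/andP: q01.
have yE : (M.+1 + a - s)%:R = M%:R + 1 + a%:R - s%:R :> R.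
  by rewrite natrB ?natrD -?natr1 //; lia.
pose si : R := (-1) ^+ (n + M + s).
pose e : R := (a%:R + b%:R + 2) / 2.
pose S (z : R) := hahn_sum q a.+1%:R b.+1%:R M n z.
have e1 : (a.+1%:R + b.+1%:R) / 2 = e by rewrite /e -!natr1; field.
have e2 : (a.+1%:R + b.+1%:R + 2) / 2 = e + 1 by rewrite /e -!natr1; field.
rewrite /low yE.
have -> : 2 * ((M + b).+1%:R / 2) - (b + s)%:R = M%:R + 1 - s%:R :> R.
  by rewrite -(natr1 (M + b)) !natrD; field.
have -> : 2 * ((M + a).+1%:R / 2) - (M%:R + 1 + a%:R - s%:R) = s%:R :> R.
  by rewrite -(natr1 (M + a)) !natrD; field.
have -> : (M.+1 + a - s).+1%:R = M%:R + a.+1%:R + 1 - s%:R :> R.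
  by rewrite -natr1 yE -(natr1 a); ring.
have -> : (b + s).+1%:R = b.+1%:R + s%:R :> R by rewrite -addSn natrD.
(* At s = M + 1 the hypothesis on f says nothing, but the factor [M+1-s] is zero there; likewise [s]
   takes care of s = 0 in [T2]. *)
have T1 : qnum q (M%:R + 1 - s%:R) * f (b + s).+1 (M.+1 + a - s)%N =
  qnum q (M%:R + 1 - s%:R) * (c * (si * q `^ ((e + 1) * s%:R) * S s%:R)).
  case: (leqP s M) => sM'.
    have -> : (M.+1 + a - s = M + a.+1 - s)%N by lia.
    by rewrite -addSn hf // /hahn_vec e2.
  have -> : s = M.+1 by lia.
  by rewrite natr1 subrr qnum0 !mul0r.
have T2 : qnum q s%:R * f (b + s)%N (M.+1 + a - s).+1 =
  qnum q s%:R * (c * (- si * q `^ ((e + 1) * (s%:R - 1)) * S (s%:R - 1))).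
  case: s sM @si {T1 yE} => [|s] sM si; first by rewrite qnum0 !mul0r.
  rewrite addnS -addSn (_ : (M.+1 + a - s.+1).+1 = M + a.+1 - s)%N; last by lia.
  rewrite hf // /hahn_vec e2 /si addnS exprS mulN1r opprK.
  by rewrite -natr1 addrK.
rewrite [X in X + _](_ : _ = qnum q (b.+1%:R + s%:R) *
  q `^ (M%:R + 1 + a%:R - s%:R - (M + a).+1%:R / 2) *
  (qnum q (M%:R + 1 - s%:R) * f (b + s).+1 (M.+1 + a - s)%N)); last by ring.
rewrite [X in _ + X](_ : _ = qnum q (M%:R + a.+1%:R + 1 - s%:R) *
  q `^ ((M + b).+1%:R / 2 - (b + s)%:R) *
  (qnum q s%:R * f (b + s)%N (M.+1 + a - s).+1)); last by ring.
rewrite T1 T2 {T1 T2 hf} /hahn_vec -/e.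
rewrite (_ : (-1) ^+ (n.+1 + M.+1 + s) = si); last first.
  by rewrite addSn addnS !addSn !exprS !mulN1r opprK.
have be0 : 0 < b.+1%:R :> R by rewrite ltr0n.
have := hahn_sum_backward a.+1%:R s%:R q01 be0 nM.
rewrite e1 -/(S _) -/(S _).
have pred (i : nat) : i.+1%:R - 1 = i%:R :> R by rewrite -natr1 addrK.
rewrite !pred; set S' := hahn_sum _ _ _ _ _ _.
rewrite -(natr1 a) -(natr1 b) -(natr1 M) -(natr1 (M + a)) -(natr1 (M + b)) => bw.
(* The two products of powers have ratio q^(2e). Multiplication by q^e then yields the pair q^e,
   q^(-e) of the backward shift. *)
have E1 : q `^ (M%:R + 1 + a%:R - s%:R - ((M + a)%:R + 1) / 2) *
    q `^ ((e + 1) * s%:R) = q `^ (((M + a)%:R + 1) / 2) * q `^ (e * s%:R).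
  by rewrite -!powR_D //; congr powR; rewrite /e natrD; field.
have E2 : q `^ (((M + b)%:R + 1) / 2 - (b + s)%:R) *
    q `^ ((e + 1) * (s%:R - 1)) = q `^ (((M + a)%:R + 1) / 2) * q `^ (e * s%:R)
    * q `^ (- e) * q `^ (- e).
  by rewrite -!powR_D //; congr powR; rewrite /e !natrD; field.
rewrite [LHS](_ : _ = c * si * (qnum q (b%:R + 1 + s%:R) *
  qnum q (M%:R + 1 - s%:R) * S s%:R *
  (q `^ (M%:R + 1 + a%:R - s%:R - ((M + a)%:R + 1) / 2) *
    q `^ ((e + 1) * s%:R)) -
  qnum q (M%:R + (a%:R + 1) + 1 - s%:R) * qnum q s%:R * S (s%:R - 1) *
  (q `^ (((M + b)%:R + 1) / 2 - (b + s)%:R) *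
    q `^ ((e + 1) * (s%:R - 1))))); last by ring.
rewrite E1 E2.
move: bw; rewrite powRN.
have := powR_neq0 e q0; set Q := q `^ e => Q0 bw.
apply: (mulfI Q0); rewrite [RHS](_ : _ =
  - (c * si * q `^ (((M + a)%:R + 1) / 2) * q `^ (e * s%:R)) *
  (- (Q * qnum q (b%:R + 1) * qnum q (M%:R + 1)) * S')); last by ring.
by rewrite -bw; field.
Qed.

(** Each lowering turns (a+1, b+1, M) into (a, b, M+1), which keeps 2 j1 = M + b and 2 j2 = M + a
    fixed; hence the start at a + n and b + n. The constant is a product of powers of q and positive
    q-numbers. *)
Lemma iter_low_hahn_vec q a b M n (c : R) (f : nat -> nat -> R) :
  0 < q < 1 ->
  (forall t, (t <= M)%N -> f (b + n + t)%N (M + (a + n) - t)%N =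
     c * hahn_vec q (a + n) (b + n) M 0 t) ->
  exists2 C : R, 0 < C & forall s, (s <= M + n)%N ->
    iter n (low q ((M + n + b)%:R / 2) ((M + n + a)%:R / 2)) f
      (b + s)%N (M + n + a - s)%N = c * C * hahn_vec q a b (M + n) n s.
Proof.
move=> q01; elim: n a b => [|n IH] a b hf.
  exists 1; first exact: ltr01.
  move=> s; rewrite !addn0 => sM; rewrite mulr1 /=.
  by have := hf s sM; rewrite !addn0.
have [|C C0 hC] := IH a.+1 b.+1.
  by move=> t tM; rewrite !addSnnS hf.
exists (C * (q `^ ((M + n + a).+1%:R / 2) * qnum q b.+1%:R * qnum q (M + n).+1%:R)).
  have q0 : 0 < q by case/andP: q01.
  apply/(mulr_gt0 C0)/mulr_gt0; last by rewrite qnum_gt0 ?ltr0n.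
  by apply: mulr_gt0; [exact: powR_gt0 | rewrite qnum_gt0 ?ltr0n].
move=> s sM; rewrite addnS !addSn iterS.
by rewrite (@low_hahn_vec _ _ _ _ n (c * C)) ?leq_addl -?addnS ?mulrA.
Qed.

End LoweredHighestWeight.

(** * From matrices on the tensor product to coefficient functions *)

Section MatrixModel.
Context {R : realType}.
Implicit Types (q : R) (J : nat).

Lemma dim_spinE J : dim_spin (J%:R / 2 : R) = J.+1.
Proof. by rewrite /dim_spin mulrC divfK ?pnatr_eq0 // natrK. Qed.

Lemma ltn_dim J (i : 'I_(dim_spin (J%:R / 2 : R))) : (i <= J)%N.
Proof. by have := ltn_ord i; rewrite [X in (_ < X)%N]dim_spinE. Qed.

(** With J = 2j and x = j + m, the quotient of consecutive factors is the matrix element of J_+.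
    After rescaling J_+ is a plain shift, and J_- carries the square of its matrix element. *)
Definition gauge q J x : R := Num.sqrt (qfact q x / qfact q (J - x)).

Lemma gauge_gt0 q J x : 0 < q < 1 -> 0 < gauge q J x.
Proof. by move=> q01; rewrite sqrtr_gt0 divr_gt0 // qfact_gt0. Qed.

Lemma gaugeS q J x : 0 < q < 1 -> (x < J)%N ->
  Num.sqrt (qnum q x.+1%:R * qnum q (J - x)%:R) * gauge q J x = gauge q J x.+1.
Proof.
move=> q01 xJ.
have h k := lt0r_neq0 (qfact_gt0 k q01).
have h' k : (0 < k)%N -> 0 < qnum q k%:R by move=> k0; rewrite qnum_gt0 ?ltr0n.
have hs : (0 < J - x)%N by rewrite subn_gt0.
rewrite /gauge -sqrtrM; last by rewrite mulr_ge0 // ltW ?h'.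
congr Num.sqrt; rewrite qfactS (_ : J - x = (J - x.+1).+1)%N; last by lia.
by rewrite qfactS; field; rewrite h lt0r_neq0 // h'.
Qed.

Lemma Jminus_gauge q J (i : 'I_(dim_spin (J%:R / 2 : R))) (F : nat -> R) :
  0 < q < 1 ->
  \sum_k Jminus q (J%:R / 2) i k * (gauge q J k * F k)%:C =
  (gauge q J i * (qnum q i.+1%:R * qnum q (J%:R - i%:R) * F i.+1))%:C.
Proof.
move=> q01; have iJ := ltn_dim i.
have wtS (k : 'I_(dim_spin (J%:R / 2 : R))) : (wt i == wt k - 1) = (k == i.+1 :> nat).
  by rewrite /wt -addrA (inj_eq (addrI _)) eq_sym subr_eq natr1 eqr_nat.
(* The row of the highest weight is zero, in agreement with the factor [J-i] = 0. *)
case: (ltnP i J) => [iJ'|Ji]; last first.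
  have -> : nat_of_ord i = J by apply/eqP; rewrite eqn_leq iJ.
  rewrite subrr qnum0 mulr0 mul0r mulr0 big1 // => k _.
  rewrite mxE wtS; case: eqP => [kE|_]; last by rewrite mul0r.
  by have := ltn_dim k; rewrite kE ltnNge Ji.
have hi : (i.+1 < dim_spin (J%:R / 2 : R))%N.
  by rewrite [X in (_ < X)%N]dim_spinE.
rewrite (bigD1 (Ordinal hi)) //= big1 ?addr0; last first.
  move=> k kE; rewrite mxE wtS ifF ?mul0r //; apply: contraNF kE => /eqP kE.
  by apply/eqP/val_inj.
rewrite mxE wtS eqxx -rmorphM /=; congr (_%:C).
rewrite /wt /= -gaugeS //.
have -> : J%:R / 2 + (- (J%:R / 2) + i.+1%:R) = i.+1%:R :> R by ring.
have -> : J%:R / 2 - (- (J%:R / 2) + i.+1%:R) + 1 = (J - i)%:R :> R.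
  by rewrite natrB // -(natr1 i); field.
set a := Num.sqrt _; have aE : a * a = qnum q i.+1%:R * qnum q (J%:R - i%:R).
  rewrite -expr2 sqr_sqrtr ?natrB // mulr_ge0 // ltW // qnum_gt0 ?ltr0n //.
  by rewrite -natrB // ltr0n subn_gt0.
rewrite -aE; ring.
Qed.

Lemma Jplus_gauge q J (i : 'I_(dim_spin (J%:R / 2 : R))) (F : nat -> R) :
  0 < q < 1 ->
  \sum_k Jplus q (J%:R / 2) i k * (gauge q J k * F k)%:C =
  (gauge q J i * (if nat_of_ord i is i'.+1 then F i' else 0))%:C.
Proof.
move=> q01; have iJ := ltn_dim i.
have wtS (k : 'I_(dim_spin (J%:R / 2 : R))) : (wt i == wt k + 1) = (i == k.+1 :> nat).
  by rewrite /wt -addrA (inj_eq (addrI _)) natr1 eqr_nat.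
case iE : (nat_of_ord i) => [|i'].
  by rewrite mulr0 big1 // => k _; rewrite mxE wtS iE mul0r.
have hi : (i' < dim_spin (J%:R / 2 : R))%N.
  by have := ltn_ord i; rewrite iE; exact: ltnW.
rewrite (bigD1 (Ordinal hi)) //= big1 ?addr0; last first.
  move=> k kE; rewrite mxE wtS iE ifF ?mul0r //; apply: contraNF kE => /eqP [kE].
  by apply/eqP/val_inj.
rewrite mxE wtS iE eqxx -rmorphM /=; congr (_%:C).
rewrite /wt /= -gaugeS //; last by rewrite -iE.
rewrite mulrA; congr (Num.sqrt _ * _ * _); rewrite mulrC; congr (qnum q _ * qnum q _).
  by rewrite -(natr1 i'); field.
by rewrite natrB; [field | rewrite ltnW // -iE].
Qed.

Lemma qJ0_sum q (e j : R) (i : 'I_(dim_spin j)) (F : nat -> R) :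
  \sum_k qJ0 q e j i k * (F k)%:C = (q `^ (e * wt i) * F i)%:C.
Proof.
rewrite (bigD1 i) //= big1 ?addr0; last first.
  by move=> k ki; rewrite !mxE eq_sym (negbTE ki) mulr0n mul0r.
by rewrite !mxE eqxx mulr1n -rmorphM.
Qed.

(** Coefficient functions are total on pairs of naturals, which avoids dependent indices; only the
    box x <= J1, y <= J2 enters the vector. *)
Definition gvec q J1 J2 (f : nat -> nat -> R) :
    'cV[R[i]]_(dim_spin (J1%:R / 2 : R) * dim_spin (J2%:R / 2 : R)) :=
  \col_k let: (x, y) := mxtens_unindex k in
    (gauge q J1 x * gauge q J2 y * f x y)%:C.

Lemma gvecE q J1 J2 f x y :
  gvec q J1 J2 f (mxtens_index (x, y)) 0 = (gauge q J1 x * gauge q J2 y * f x y)%:C.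
Proof. by rewrite mxE mxtens_indexK. Qed.

Lemma big_mxtens (V : nmodType) m n (F : 'I_(m * n) -> V) :
  \sum_k F k = \sum_i \sum_j F (mxtens_index (i, j)).
Proof.
rewrite pair_big /= (reindex (@mxtens_index m n)) /=.
  by apply: eq_bigr => -[].
by exists (@mxtens_unindex m n) => k _; rewrite ?mxtens_indexK ?mxtens_unindexK.
Qed.

Lemma tensmx_gvec q J1 J2 f (A : 'M[R[i]]_(dim_spin (J1%:R / 2 : R)))
    (B : 'M[R[i]]_(dim_spin (J2%:R / 2 : R))) x y :
  ((A *t B) *m gvec q J1 J2 f) (mxtens_index (x, y)) 0 =
  \sum_x' \sum_y' A x x' * B y y' * (gauge q J1 x' * gauge q J2 y' * f x' y')%:C.
Proof.
rewrite mxE big_mxtens; apply: eq_bigr => x' _; apply: eq_bigr => y' _.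
by rewrite gvecE tensmxE.
Qed.

Lemma col_tensP m n (u v : 'cV[R[i]]_(m * n)) :
  (forall x y, u (mxtens_index (x, y)) 0 = v (mxtens_index (x, y)) 0) -> u = v.
Proof.
by move=> h; apply/colP => k; rewrite -(mxtens_unindexK k); case: mxtens_unindex.
Qed.

(** The parameter [v] is the action of row x of A on coefficient functions, so that J_- and J_+
    share the computation. *)
Lemma tens_qJ0_gvec q J1 J2 f (A : 'M[R[i]]_(dim_spin (J1%:R / 2 : R)))
    (e : R) x y (v : (nat -> R) -> R) :
  (forall F : nat -> R,
    \sum_k A x k * (gauge q J1 k * F k)%:C = (gauge q J1 x * v F)%:C) ->
  ((A *t qJ0 q e (J2%:R / 2)) *m gvec q J1 J2 f) (mxtens_index (x, y)) 0 =
  (gauge q J1 x * v (fun x' => q `^ (e * wt y) * gauge q J2 y * f x' y))%:C.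
Proof.
move=> hA; rewrite tensmx_gvec -hA; apply: eq_bigr => x' _.
rewrite (eq_bigr (fun y' : 'I_(dim_spin (J2%:R / 2)) =>
  A x x' * (qJ0 q e (J2%:R / 2) y y' *
  (gauge q J2 y' * (gauge q J1 x' * f x' y'))%:C))); last first.
  by move=> y' _; rewrite -mulrA; do 2!congr (_ * _); congr (_%:C); ring.
rewrite -mulr_sumr (qJ0_sum _ _ _
  (fun y' => gauge q J2 y' * (gauge q J1 x' * f x' y'))).
by congr (_ * _); congr (_%:C); ring.
Qed.

Lemma qJ0_tens_gvec q J1 J2 f (B : 'M[R[i]]_(dim_spin (J2%:R / 2 : R)))
    (e : R) x y (v : (nat -> R) -> R) :
  (forall F : nat -> R,
    \sum_k B y k * (gauge q J2 k * F k)%:C = (gauge q J2 y * v F)%:C) ->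
  ((qJ0 q e (J1%:R / 2) *t B) *m gvec q J1 J2 f) (mxtens_index (x, y)) 0 =
  (gauge q J2 y * v (fun y' => q `^ (e * wt x) * gauge q J1 x * f x y'))%:C.
Proof.
move=> hB; rewrite tensmx_gvec exchange_big -hB; apply: eq_bigr => y' _.
rewrite (eq_bigr (fun x' : 'I_(dim_spin (J1%:R / 2)) =>
  B y y' * (qJ0 q e (J1%:R / 2) x x' *
  (gauge q J1 x' * (gauge q J2 y' * f x' y'))%:C))); last first.
  move=> x' _; rewrite -mulrA mulrCA; do 2!congr (_ * _); congr (_%:C); ring.
rewrite -mulr_sumr (qJ0_sum _ _ _
  (fun x' => gauge q J1 x' * (gauge q J2 y' * f x' y'))).
by congr (_ * _); congr (_%:C); ring.
Qed.

Lemma Jminus12_gvec q J1 J2 f : 0 < q < 1 ->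
  Jminus12 q (J1%:R / 2) (J2%:R / 2) *m gvec q J1 J2 f =
  gvec q J1 J2 (low q (J1%:R / 2) (J2%:R / 2) f).
Proof.
move=> q01; apply: col_tensP => x y.
rewrite gvecE mulmxDl mxE.
rewrite (tens_qJ0_gvec _ _ _ (fun F => Jminus_gauge x F q01)).
rewrite (qJ0_tens_gvec _ _ _ (fun F => Jminus_gauge y F q01)).
rewrite -rmorphD /=; congr (_%:C); rewrite /low /wt.
have j2 (J : nat) : 2 * (J%:R / 2) = J%:R :> R by field.
rewrite !j2 mul1r mulN1r opprD opprK (addrC (- _)); ring.
Qed.

Lemma Jplus12_gvec q J1 J2 f : 0 < q < 1 ->
  Jplus12 q (J1%:R / 2) (J2%:R / 2) *m gvec q J1 J2 f =
  gvec q J1 J2 (rise q (J1%:R / 2) (J2%:R / 2) f).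
Proof.
move=> q01; apply: col_tensP => x y.
rewrite gvecE mulmxDl mxE.
rewrite (tens_qJ0_gvec _ _ _ (fun F => Jplus_gauge x F q01)).
rewrite (qJ0_tens_gvec _ _ _ (fun F => Jplus_gauge y F q01)).
rewrite -rmorphD /=; congr (_%:C); rewrite /rise /wt.
rewrite mul1r mulN1r opprD opprK (addrC (- _)).
by case: (nat_of_ord x) => [|?]; case: (nat_of_ord y) => [|?]; ring.
Qed.

(** The entries being real, this is adjointness: the image of J_- is orthogonal to the kernel of
    J_+. *)
Lemma Jplus12T q J1 J2 :
  (Jplus12 q (J1%:R / 2) (J2%:R / 2))^T = Jminus12 q (J1%:R / 2 : R) (J2%:R / 2).
Proof.
have hT (J : nat) : (Jplus q (J%:R / 2))^T = Jminus q (J%:R / 2 : R).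
  apply/matrixP => i k; rewrite !mxE eq_sym (_ : (wt i == _) = (wt i + 1 == wt k)).
    case: eqP => // <-; congr (Num.sqrt _)%:C; rewrite mulrC.
    by congr (qnum q _ * qnum q _); ring.
  by rewrite [LHS]eq_sym subr_eq eq_sym.
by rewrite /Jplus12 linearD /= !trmx_tens !hT !tr_diag_mx.
Qed.

End MatrixModel.

(** * Scalar products and the kernel of J_+ in a weight space *)

Section HighestWeight.
Context {R : realType}.
Implicit Types (q : R) (f g : nat -> nat -> R).

Lemma eq_gvec q J1 J2 f g :
  (forall x y, (x <= J1)%N -> (y <= J2)%N -> f x y = g x y) ->
  gvec q J1 J2 f = gvec q J1 J2 g.
Proof.
by move=> fg; apply: col_tensP => x y; rewrite !gvecE fg // ltn_dim.
Qed.

Lemma gvec0 q J1 J2 : gvec q J1 J2 (fun _ _ => 0) = 0.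
Proof. by apply: col_tensP => x y; rewrite gvecE mulr0 mxE. Qed.

Lemma gvec_sum q J1 J2 n (c : nat -> R) (F : nat -> nat -> nat -> R) :
  gvec q J1 J2 (fun x y => \sum_(r < n) c r * F r x y) =
  \sum_(r < n) (c r)%:C *: gvec q J1 J2 (F r).
Proof.
apply: col_tensP => x y; rewrite gvecE summxE mulr_sumr rmorph_sum /=.
by apply: eq_bigr => r _; rewrite mxE gvecE -rmorphM /=; congr (_%:C); ring.
Qed.

Lemma gvecZ q J1 J2 (c : R) f :
  gvec q J1 J2 (fun x y => c * f x y) = c%:C *: gvec q J1 J2 f.
Proof.
apply: col_tensP => x y; rewrite gvecE mxE gvecE -rmorphM /=.
by congr (_%:C); ring.
Qed.

Lemma Jminus12X_gvec q J1 J2 k f : 0 < q < 1 ->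
  Jminus12 q (J1%:R / 2) (J2%:R / 2) ^+ k *m gvec q J1 J2 f =
  gvec q J1 J2 (iter k (low q (J1%:R / 2) (J2%:R / 2)) f).
Proof.
move=> q01; elim: k => [|k IH]; first by rewrite expr0 mul1mx.
by rewrite exprS -mulmxE -mulmxA IH Jminus12_gvec.
Qed.

Lemma Jplus12X_gvec q J1 J2 k f : 0 < q < 1 ->
  Jplus12 q (J1%:R / 2) (J2%:R / 2) ^+ k *m gvec q J1 J2 f =
  gvec q J1 J2 (iter k (rise q (J1%:R / 2) (J2%:R / 2)) f).
Proof.
move=> q01; elim: k => [|k IH]; first by rewrite expr0 mul1mx.
by rewrite exprS -mulmxE -mulmxA IH Jplus12_gvec.
Qed.

Lemma gvec_dot q J1 J2 f g :
  ((gvec q J1 J2 f)^T *m gvec q J1 J2 g) 0 0 =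
  (\sum_(x < J1.+1) \sum_(y < J2.+1)
     (gauge q J1 x * gauge q J2 y) ^+ 2 * (f x y * g x y))%:C.
Proof.
pose F x y := (gauge q J1 x * gauge q J2 y) ^+ 2 * (f x y * g x y).
(* The dimension equals J + 1 only propositionally, so the sums pass through intervals of naturals,
   where it can be rewritten. *)
transitivity (\sum_(0 <= x < dim_spin (J1%:R / 2 : R))
    \sum_(0 <= y < dim_spin (J2%:R / 2 : R)) F x y)%:C.
  rewrite mxE big_mxtens big_mkord rmorph_sum; apply: eq_bigr => x _ /=.
  rewrite big_mkord rmorph_sum; apply: eq_bigr => y _.
  by rewrite mxE !gvecE -rmorphM /=; congr (_%:C); rewrite /F; ring.
rewrite !dim_spinE big_mkord; congr (_%:C); apply: eq_bigr => x _.
by rewrite big_mkord.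
Qed.

(** The antidiagonal x + y = M + a + b meets the box exactly in the M + 1 points (b + s, M + a -
    s). *)
Lemma sum_antidiagonal a b M J1 J2 (F : nat -> nat -> R) :
  J1 = (M + b)%N -> J2 = (M + a)%N ->
  (forall x y, (x + y)%N != (M + a + b)%N -> F x y = 0) ->
  \sum_(x < J1.+1) \sum_(y < J2.+1) F x y =
  \sum_(s < M.+1) F (b + s)%N (M + a - s)%N.
Proof.
move=> -> -> hF.
have inner_sum x : (x <= M + b)%N -> \sum_(y < (M + a).+1) F x y =
    if (b <= x)%N then F x (M + a + b - x)%N else 0.
  move=> xM; case: leqP => bx; last first.
    by rewrite big1 // => y _; apply: hF; have := ltn_ord y; lia.
  have hy : (M + a + b - x < (M + a).+1)%N by lia.
  rewrite (bigD1 (Ordinal hy)) //= big1 ?addr0 // => y yE; apply: hF.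
  by apply: contra yE => /eqP yE; apply/eqP/val_inj => /=; lia.
rewrite (eq_bigr (fun x : 'I_(M + b).+1 =>
   if (b <= x)%N then F x (M + a + b - x)%N else 0)); last first.
  by move=> x _; apply: inner_sum; rewrite -ltnS.
rewrite -big_mkcond /= -(big_mkord (leq b) (fun x => F x (M + a + b - x)%N)).
transitivity (\sum_(b <= x < (M + b).+1) F x (M + a + b - x)%N).
  by rewrite (big_nat_widenl b 0).
rewrite -{1}[b]add0n -addSn big_addn addnK big_mkord.
by apply: eq_bigr => s _; rewrite addnC; congr F; have := ltn_ord s; lia.
Qed.

(** The explicit highest weight vector, of weight (a + b) / 2. On its antidiagonal y <= M + a forces
    b <= x, so x - b is exact in the box. *)
Definition hw_vec q a b M x y : R :=
  if (x + y == M + a + b)%N then hahn_vec q a b M 0 (x - b) else 0.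

Lemma hahn_vec0S q a b M s : 0 < q ->
  hahn_vec q a b M 0 s.+1 = - (q `^ ((a%:R + b%:R + 2) / 2) * hahn_vec q a b M 0 s).
Proof.
move=> q0; rewrite !hahn_vec0 addnS exprS -(natr1 s) mulrDr mulr1 powR_D //; ring.
Qed.

(** The right side is the exponent of q in the ratio of the two coefficients of J_+ at (x, y). As it
    is constant on the antidiagonal, solutions of J_+ f = 0 are geometric progressions with
    alternating signs. *)
Lemma hw_weightE a b M x y : (x + y = (M + a + b).+1)%N ->
  (a%:R + b%:R + 2) / 2 = (y%:R - (M + a)%:R / 2) - ((M + b)%:R / 2 - x%:R) :> R.
Proof.
move=> xy; have := congr1 (fun k : nat => k%:R : R) xy.
rewrite -natr1 !natrD => h.
suff -> : x%:R = M%:R + a%:R + b%:R + 1 - y%:R :> R by field.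
by rewrite -h; ring.
Qed.

Lemma rise_hw_vec q a b M x y : 0 < q < 1 -> (x <= M + b)%N -> (y <= M + a)%N ->
  rise q ((M + b)%:R / 2) ((M + a)%:R / 2) (hw_vec q a b M) x y = 0.
Proof.
move=> q01 xM yM; have q0 : 0 < q by case/andP: q01.
case: (eqVneq (x + y)%N (M + a + b).+1) => xy; last first.
  rewrite /rise; case: x xM xy => [|x] xM xy; case: y yM xy => [|y] yM xy;
    rewrite /hw_vec ?mulr0 ?addr0 ?add0r //.
  - by rewrite ifF ?mulr0 //; apply: contraNF xy => /eqP <-; rewrite ?addnS.
  - by rewrite ifF ?mulr0 //; apply: contraNF xy => /eqP <-; rewrite ?addSn.
  rewrite !ifF ?mulr0 ?addr0 //; apply: contraNF xy => /eqP <-;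
  by rewrite ?addSn ?addnS.
have h := hw_weightE xy.
case: x xM xy h => [|x] xM xy h; first by lia.
case: y yM xy h => [|y] yM xy h; first by lia.
have xb : (b <= x)%N by lia.
rewrite /rise /hw_vec !ifT; try by apply/eqP; lia.
rewrite subSn // hahn_vec0S // h [q `^ (_ - _ - (_ - _))]powR_D // powRN.
by field; rewrite powR_neq0.
Qed.

(** A two-term recurrence along the antidiagonal determines f from its value at t = 0, where
    [hahn_vec] equals (-1)^M. *)
Lemma rise_eq0_hw q a b M f : 0 < q < 1 ->
  (forall x y, (x <= M + b)%N -> (y <= M + a)%N ->
     rise q ((M + b)%:R / 2) ((M + a)%:R / 2) f x y = 0) ->
  forall t, (t <= M)%N -> f (b + t)%N (M + a - t)%N =
    ((-1) ^+ M * f b (M + a)%N) * hahn_vec q a b M 0 t.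
Proof.
move=> q01 hf; have q0 : 0 < q by case/andP: q01.
elim=> [|t IH] tM.
  rewrite addn0 subn0 hahn_vec0 mulr0 powRr0 addn0 mulr1.
  by rewrite mulrAC -expr2 sqrr_sign mul1r.
rewrite hahn_vec0S // mulrN mulrCA -IH ?(ltnW tM) //.
have yE : (M + a - t = (M + a - t.+1).+1)%N by lia.
have xM : ((b + t).+1 <= M + b)%N by lia.
have yM : ((M + a - t.+1).+1 <= M + a)%N by lia.
have xy : ((b + t).+1 + (M + a - t.+1).+1 = (M + a + b).+1)%N by lia.
rewrite yE addnS; have := hf _ _ xM yM; rewrite /rise.
rewrite (hw_weightE xy) [q `^ (_ - _ - (_ - _))]powR_D // powRN.
set A := q `^ _; set B := q `^ _; move=> /eqP; rewrite addrC addr_eq0 => /eqP h.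
have B0 : B != 0 by exact: powR_neq0.
by apply: (mulfI B0); rewrite h; field.
Qed.

End HighestWeight.

(** * The projected vector and the sign of its coefficients *)

Section ProjectedVector.
Context {R : realType}.
Implicit Types (q : R) (f g : nat -> nat -> R).

(** A neighbour outside the box carries the factor [J1-x] or [J2-y], which is zero at the border. *)
Lemma low_eq0 q J1 J2 f :
  (forall x y, (x <= J1)%N -> (y <= J2)%N -> f x y = 0) ->
  forall x y, (x <= J1)%N -> (y <= J2)%N ->
    low q (J1%:R / 2) (J2%:R / 2) f x y = 0.
Proof.
move=> f0 x y xJ yJ; have j2 (J : nat) : 2 * (J%:R / 2) = J%:R :> R by field.
have T1 : qnum q (J1%:R - x%:R) * f x.+1 y = 0.
  move: xJ; rewrite leq_eqVlt => /orP[/eqP ->|xJ]; last by rewrite f0 ?mulr0.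
  by rewrite subrr qnum0 mul0r.
have T2 : qnum q (J2%:R - y%:R) * f x y.+1 = 0.
  move: yJ; rewrite leq_eqVlt => /orP[/eqP ->|yJ]; last by rewrite f0 ?mulr0.
  by rewrite subrr qnum0 mul0r.
rewrite /low !j2 [X in X + _]mulrAC -[X in X * _ + _]mulrA T1.
by rewrite [X in _ + X]mulrAC -[X in _ + X * _]mulrA T2 !mulr0 !mul0r addr0.
Qed.

Lemma iter_low_eq0 q J1 J2 k f :
  (forall x y, (x <= J1)%N -> (y <= J2)%N -> f x y = 0) ->
  forall x y, (x <= J1)%N -> (y <= J2)%N ->
    iter k (low q (J1%:R / 2) (J2%:R / 2)) f x y = 0.
Proof. by move=> f0; elim: k => //= k IH; exact: low_eq0. Qed.

Definition gdelta q J1 J2 x0 y0 x y : R :=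
  if (x == x0) && (y == y0) then (gauge q J1 x0 * gauge q J2 y0)^-1 else 0.

Lemma ket12E J1 J2 x0 y0 x y :
  ket12 (J1%:R / 2) (J2%:R / 2) (x0%:R - J1%:R / 2) (y0%:R - J2%:R / 2 : R)
    (mxtens_index (x, y)) 0 = ((x == x0 :> nat) && (y == y0 :> nat))%:R.
Proof.
rewrite /ket12 /tensmx !mxE mxtens_indexK /= /wt.
by rewrite !(addrC (- _)) !(inj_eq (addIr _)) !eqr_nat -natrM mulnb.
Qed.

Lemma ket12_gvec q J1 J2 x0 y0 : 0 < q < 1 ->
  ket12 (J1%:R / 2) (J2%:R / 2) (x0%:R - J1%:R / 2) (y0%:R - J2%:R / 2 : R) =
  gvec q J1 J2 (gdelta q J1 J2 x0 y0).
Proof.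
move=> q01; apply: col_tensP => x y; rewrite ket12E gvecE /gdelta.
case: ifP => [/andP[/eqP -> /eqP ->]|_]; last by rewrite mulr0.
by rewrite divff // mulf_neq0 // gt_eqF // gauge_gt0.
Qed.

(* P^j_{jj} |j1 j1>|j2 j-j1> up to a positive factor, with 2 j1 = M + b,
   2 j2 = M + a and 2 j = a + b. *)
Definition hw_proj q a b M : nat -> nat -> R := fun x y =>
  \sum_(r < (M + b).+1 + (M + a).+1) projC q (a + b) r *
    iter r (low q ((M + b)%:R / 2) ((M + a)%:R / 2))
      (iter r (rise q ((M + b)%:R / 2) ((M + a)%:R / 2))
        (gdelta q (M + b) (M + a) (M + b) a)) x y.

Lemma gdelta_of_weight q J1 J2 x0 y0 :
  of_weight (x0%:R + y0%:R) (gdelta q J1 J2 x0 y0).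
Proof.
move=> x y xy; rewrite /gdelta; case: ifP => // /andP[/eqP xE /eqP yE].
by rewrite xE yE eqxx in xy.
Qed.

Lemma hw_proj_of_weight q a b M : of_weight (M + b + a)%:R (hw_proj q a b M).
Proof.
move=> x y xy; rewrite /hw_proj big1 // => r _.
have := @gdelta_of_weight q (M + b) (M + a) (M + b) a.
move/(@iter_rise_of_weight _ q ((M + b)%:R / 2) ((M + a)%:R / 2) r).
move/(@iter_low_of_weight _ q ((M + b)%:R / 2) ((M + a)%:R / 2) r).
by rewrite addrK -natrD => ->; rewrite ?mulr0.
Qed.

Lemma rise_hw_proj q a b M x y : 0 < q < 1 -> (x <= M + b)%N -> (y <= M + a)%N ->
  rise q ((M + b)%:R / 2) ((M + a)%:R / 2) (hw_proj q a b M) x y = 0.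
Proof.
move=> q01 xM yM; rewrite /hw_proj addSn.
have w0 := @gdelta_of_weight q (M + b) (M + a) (M + b) a.
rewrite (rise_extremal _ _ _ q01 w0); last by rewrite !natrD; field.
(* The surviving term raises the weight beyond the largest one in the box, hence vanishes there. *)
rewrite iter_low_eq0 ?mulr0 // => {}x {}y {}xM {}yM.
have := @iter_rise_of_weight _ q ((M + b)%:R / 2) ((M + a)%:R / 2)
  (M + b + (M + a).+1).+1 _ _ w0 x y.
by apply; rewrite -!natrD eqr_nat; lia.
Qed.

Lemma projC0 q d : 0 < q < 1 -> projC q d 0 = 1.
Proof.
move=> q01; rewrite /projC expr0 mul1r addn0 {2}/qfact big_ord0 mul1r divff //.
by rewrite gt_eqF // qfact_gt0.
Qed.

(** Proportionality is [rise_eq0_hw]. For the sign of c both u and |j1 j1>|j2 j-j1> are paired with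
    [hw_vec]: the pairings agree, the first is c times a sum of squares, the second is positive. *)
Lemma hw_proj_hahn_vec q a b M : 0 < q < 1 ->
  exists2 c : R, 0 < c & forall t, (t <= M)%N ->
    hw_proj q a b M (b + t)%N (M + a - t)%N = c * hahn_vec q a b M 0 t.
Proof.
move=> q01; have q0 : 0 < q by case/andP: q01.
have hE := rise_eq0_hw q01 (fun x y hx hy => rise_hw_proj q01 hx hy).
pose c : R := (-1) ^+ M * hw_proj q a b M b (M + a)%N; exists c; last exact: hE.
pose J1 := (M + b)%N; pose J2 := (M + a)%N.
pose G := hw_vec q a b M; pose u := hw_proj q a b M.
pose dl := gdelta q J1 J2 J1 a.
have GJ : (gvec q J1 J2 G)^T *m Jminus12 q (J1%:R / 2) (J2%:R / 2) = 0.
  rewrite -Jplus12T -trmx_mul Jplus12_gvec // -[RHS]trmx0; congr (_^T).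
  rewrite -(gvec0 q); apply: eq_gvec => x y hx hy; exact: rise_hw_vec.
have Gu : (gvec q J1 J2 G)^T *m gvec q J1 J2 u =
    (gvec q J1 J2 G)^T *m gvec q J1 J2 dl.
  rewrite /u /hw_proj (gvec_sum _ _ _ _ (projC q (a + b))
    (fun r => iter r (low q (J1%:R / 2) (J2%:R / 2))
      (iter r (rise q (J1%:R / 2) (J2%:R / 2)) dl))).
  (* Terms with r > 0 begin with J_- and vanish by [GJ]; r = 0 gives the basis vector itself. *)
  rewrite mulmx_sumr addSn big_ord_recl /= big1 ?addr0.
    by rewrite projC0 // scale1r.
  move=> r _; rewrite -scalemxAr -Jminus12_gvec //.
  by rewrite mulmxA GJ mul0mx scaler0.
have := congr1 (fun A : 'M_1 => A 0 0) Gu; rewrite !gvec_dot => /complexI.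
have Gsupp x y : (x + y)%N != (M + a + b)%N -> G x y = 0.
  by rewrite /G /hw_vec => /negbTE ->.
rewrite (sum_antidiagonal (a := a) (b := b) (M := M) erefl erefl (F := fun x y =>
    (gauge q J1 x * gauge q J2 y) ^+ 2 * (G x y * u x y))); last first.
  by move=> x y xy; rewrite Gsupp // mul0r mulr0.
rewrite (sum_antidiagonal (a := a) (b := b) (M := M) erefl erefl (F := fun x y =>
    (gauge q J1 x * gauge q J2 y) ^+ 2 * (G x y * dl x y))); last first.
  by move=> x y xy; rewrite Gsupp // mul0r mulr0.
have GE t : (t <= M)%N -> G (b + t)%N (M + a - t)%N = hahn_vec q a b M 0 t.
  by move=> tM; rewrite /G /hw_vec ifT ?addKn //; apply/eqP; lia.
rewrite (eq_bigr (fun s : 'I_M.+1 => c *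
   ((gauge q J1 (b + s) * gauge q J2 (M + a - s)) * hahn_vec q a b M 0 s) ^+ 2)).
  (* The basis vector sits at x = 2 j1, the endpoint t = M, where [hahn_vec] is positive. *)
  rewrite -mulr_sumr [RHS]big_ord_recr /= [in RHS]big1 ?add0r; last first.
    move=> i _; rewrite /dl /gdelta ifF ?mulr0 //; apply/negbTE.
    by rewrite negb_and; have := ltn_ord i; rewrite /J1; lia.
  have hh : 0 < hahn_vec q a b M 0 M.
    by rewrite hahn_vec0 addnn -mul2n exprM sqrrN !expr1n mul1r powR_gt0.
  rewrite GE // /dl /gdelta (addnC b M) (addKn M a) /J1 !eqxx /= => h.
  have gp x y : 0 < gauge q J1 x * gauge q J2 y.
    by apply: mulr_gt0; apply: gauge_gt0.
  have cS : 0 < c * \sum_(i < M.+1)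
    ((gauge q J1 (b + i) * gauge q J2 (M + a - i)) * hahn_vec q a b M 0 i) ^+ 2.
    rewrite h; apply: mulr_gt0; first exact: exprn_gt0 (gp _ _).
    by apply: mulr_gt0; rewrite // invr_gt0; exact: gp.
  move: cS; set S := \sum_(i < _) _ => cS.
  have S_ge0 : 0 <= S by apply: sumr_ge0 => i _; exact: sqr_ge0.
  have S_gt0 : 0 < S.
    by rewrite lt0r S_ge0 andbT; apply/eqP => s0; move: cS; rewrite s0 mulr0 ltxx.
  by rewrite -(pmulr_lgt0 _ S_gt0).
move=> i _; have iM : (i <= M)%N by rewrite -ltnS.
by rewrite GE // /u hE // -/c; ring.
Qed.

End ProjectedVector.

(** * Clebsch-Gordan coefficients as normalised lowered vectors *)

Section ClebschGordan.
Context {R : realType}.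
Implicit Types (q : R) (a b M n s : nat).

Lemma inner_gvec q J1 J2 f g :
  inner (gvec q J1 J2 f) (gvec q J1 J2 g) =
  ((gvec q J1 J2 f)^T *m gvec q J1 J2 g) 0 0.
Proof.
rewrite /inner mxE; apply: eq_bigr => k _.
rewrite !mxE; case: mxtens_unindex => x y.
by rewrite conj_Creal //; apply/complex_realP; eexists.
Qed.

Lemma inner_ket12 J1 J2 x y w : (x <= J1)%N -> (y <= J2)%N ->
  exists (i : 'I_(dim_spin (J1%:R / 2 : R))) (k : 'I_(dim_spin (J2%:R / 2 : R))),
    [/\ i = x :> nat, k = y :> nat &
  inner (ket12 (J1%:R / 2) (J2%:R / 2)
    (x%:R - J1%:R / 2) (y%:R - J2%:R / 2 : R)) w =
  w (mxtens_index (i, k)) 0].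
Proof.
move=> xJ yJ.
have hx : (x < dim_spin (J1%:R / 2 : R))%N by rewrite dim_spinE.
have hy : (y < dim_spin (J2%:R / 2 : R))%N by rewrite dim_spinE.
exists (Ordinal hx), (Ordinal hy); split=> //.
pose k0 := mxtens_index (Ordinal hx, Ordinal hy).
rewrite /inner (bigD1 k0) //=.
rewrite ket12E !eqxx conjC1 mul1r big1 ?addr0 // => k.
rewrite -(mxtens_unindexK k); case: (mxtens_unindex k) => x' y' ne.
rewrite ket12E; case: andP => [[/eqP xE /eqP yE]|_]; last by rewrite conjC0 mul0r.
have x'E : x' = Ordinal hx by exact/val_inj.
have y'E : y' = Ordinal hy by exact/val_inj.
by rewrite x'E y'E eqxx in ne.
Qed.

Lemma sqrtC_real (x : R) : 0 <= x -> sqrtC x%:C = (Num.sqrt x)%:C.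
Proof.
move=> x0; rewrite -{1}(sqr_sqrtr x0) rmorphXn /= sqrCK //.
by rewrite ler0c sqrtr_ge0.
Qed.

(** Since j - m = n, every term contains J_-^(r+n) = J_-^n J_-^r, so J_-^n factors out of the sum; K
    is the square root in front. The remaining sum has parameters a + n and b + n, whose sum is
    2j. *)
Lemma projP_gvec q a b M n (j m : R) : 0 < q < 1 ->
  j = (a%:R + b%:R) / 2 + n%:R -> m = (a%:R + b%:R) / 2 ->
  let J1 := (M + (b + n))%N in let J2 := (M + (a + n))%N in
  exists2 K : R, 0 < K &
  projP q (J1%:R / 2) (J2%:R / 2) j m *m
    ket12 (J1%:R / 2) (J2%:R / 2) (J1%:R / 2) (j - J1%:R / 2) =
  gvec q J1 J2 (fun x y => K *
    iter n (low q (J1%:R / 2) (J2%:R / 2)) (hw_proj q (a + n) (b + n) M) x y).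
Proof.
move=> q01 jE mE J1 J2.
have dE : Num.truncn (2 * j) = (a + n + (b + n))%N.
  by rewrite (_ : 2 * j = (a + n + (b + n))%:R) ?natrK // jE !natrD; field.
have nE : Num.truncn (j - m) = n by rewrite jE mE addrC addKr natrK.
rewrite /projP dE nE.
set K := Num.sqrt _; exists K.
  by rewrite sqrtr_gt0 divr_gt0 ?mulr_gt0 // qfact_gt0.
have -> : ket12 (J1%:R / 2) (J2%:R / 2) (J1%:R / 2) (j - J1%:R / 2) =
    gvec q J1 J2 (gdelta q J1 J2 J1 (a + n)).
  rewrite -ket12_gvec //; congr ket12; first by field.
  by rewrite jE /J1 /J2 !natrD; field.
rewrite gvecZ -scalemxAl; congr (_ *: _).
rewrite /hw_proj (iter_low_sum _ _ _ _ _ (projC q (a + n + (b + n)))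
  (fun r => iter r (low q (J1%:R / 2) (J2%:R / 2))
      (iter r (rise q (J1%:R / 2) (J2%:R / 2)) (gdelta q J1 J2 J1 (a + n))))).
rewrite (gvec_sum _ _ _ _ _ (fun r => iter n (low q (J1%:R / 2) (J2%:R / 2))
  (iter r (low q (J1%:R / 2) (J2%:R / 2))
      (iter r (rise q (J1%:R / 2) (J2%:R / 2)) (gdelta q J1 J2 J1 (a + n)))))).
pose G (r : nat) := (projC q (a + n + (b + n)) r)%:C *:
  (Jminus12 q (J1%:R / 2) (J2%:R / 2) ^+ (r + n) *
   Jplus12 q (J1%:R / 2) (J2%:R / 2) ^+ r) *m
  gvec q J1 J2 (gdelta q J1 J2 J1 (a + n)).
pose D := (dim_spin (J1%:R / 2 : R) + dim_spin (J2%:R / 2 : R))%N.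
transitivity (\sum_(0 <= r < D) G r).
  by rewrite mulmx_suml big_mkord.
have -> : (D = J1.+1 + J2.+1)%N by rewrite /D !dim_spinE.
rewrite big_mkord; apply: eq_bigr => r _.
rewrite /G -scalemxAl -mulmxE -mulmxA Jplus12X_gvec // Jminus12X_gvec //.
by rewrite [(r + n)%N]addnC iterD.
Qed.

(** The positive constants K, c and C cancel in the normalisation, which leaves the unit vector
    along [hahn_vec]. *)
Lemma clebsch_gordanE q a b M n s (j m : R) : 0 < q < 1 ->
  j = (a%:R + b%:R) / 2 + n%:R -> m = (a%:R + b%:R) / 2 -> (s <= M + n)%N ->
  let J1 := (M + (b + n))%N in let J2 := (M + (a + n))%N in
  let w t := gauge q J1 (b + t) * gauge q J2 (M + n + a - t) in
  clebsch_gordan q (J1%:R / 2) ((b + s)%:R - J1%:R / 2) (J2%:R / 2)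
    ((M + n + a - s)%:R - J2%:R / 2) j m =
  (w s * hahn_vec q a b (M + n) n s /
   Num.sqrt (\sum_(t < (M + n).+1) (w t * hahn_vec q a b (M + n) n t) ^+ 2))%:C.
Proof.
move=> q01 jE mE sM J1 J2 w.
have [c c0 hw] := hw_proj_hahn_vec (a + n) (b + n) M q01.
have [C C0 hC] := iter_low_hahn_vec q01 hw.
have [K K0 hK] := projP_gvec M q01 jE mE.
rewrite /clebsch_gordan /coupled {}hK -/J1 -/J2.
have J1E : (M + n + b = J1)%N by rewrite /J1; lia.
have J2E : (M + n + a = J2)%N by rewrite /J2; lia.
rewrite J1E J2E in hC.
set v := fun x y => _.
have vE t : (t <= M + n)%N -> v (b + t)%N (M + n + a - t)%N =
    K * c * C * hahn_vec q a b (M + n) n t.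
  by move=> tM; rewrite /v J2E hC // !mulrA.
have vsupp x y : (x + y)%N != (M + n + a + b)%N -> v x y = 0.
  move=> xy; rewrite /v.
  have := @hw_proj_of_weight _ q (a + n) (b + n) M.
  move/(@iter_low_of_weight _ q (J1%:R / 2) (J2%:R / 2) n) => ->; rewrite ?mulr0 //.
  by rewrite eq_sym subr_eq eq_sym -!natrD eqr_nat; lia.
set S := \sum_(t < _) _.
have S0 : 0 <= S by apply: sumr_ge0 => t _; exact: sqr_ge0.
have k0 : 0 < K * c * C by rewrite !mulr_gt0.
have -> : vnorm (gvec q J1 J2 v) = (K * c * C * Num.sqrt S)%:C.
  rewrite /vnorm inner_gvec gvec_dot.
  rewrite (_ : \sum_(x < _) _ = (K * c * C) ^+ 2 * S).
    rewrite sqrtC_real; last by rewrite mulr_ge0 ?sqr_ge0.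
    rewrite sqrtrM ?sqr_ge0 //.
    by rewrite sqrtr_sqr gtr0_norm.
  rewrite (sum_antidiagonal (a := a) (b := b) (M := (M + n)%N)
    (esym J1E) (esym J2E) (F := fun x y => (gauge q J1 x * gauge q J2 y) ^+ 2 * (v x y * v x y))).
    rewrite mulr_sumr; apply: eq_bigr => t _.
    have tM : (t <= M + n)%N by rewrite -ltnS.
    by rewrite vE // /w; ring.
  by move=> x y xy; rewrite vsupp // mulr0 mulr0.
have xJ : (b + s <= J1)%N by rewrite -J1E addnC leq_add2r.
have yJ : (M + n + a - s <= J2)%N by rewrite -J2E leq_subr.
have [i [k [iE kE ->]]] :=
  inner_ket12 ((K * c * C * Num.sqrt S)%:C^-1 *: gvec q J1 J2 v) xJ yJ.
rewrite mxE gvecE iE kE vE // -fmorphV -rmorphM /=; congr (_%:C).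
rewrite -/(w s) invfM.
have k1 : K * c * C != 0 by rewrite gt_eqF.
by move: (K * c * C) k1 (Num.sqrt S)^-1 => k' k1 r; field.
Qed.

End ClebschGordan.

(** * Normalised q-Hahn polynomials in terms of the rescaled basis *)

Section HahnPolynomials.
Context {R : realType}.
Implicit Types (q : R) (a b M n s : nat).

(** Apart from (-1)^n the factors in front of the sum are positive. The sum extends from min(n, s)
    to n because (-s|q)_k = 0 for k > s. *)
Lemma qhahnE q a b M n : 0 < q < 1 -> (n <= M)%N ->
  exists2 P : R, 0 < P & forall s,
    qhahn q a%:R b%:R M.+1 n s = (-1) ^+ n * P * hahn_sum q a%:R b%:R M n s%:R.
Proof.
move=> q01 nM; have q0 : 0 < q by case/andP: q01.
exists (q `^ (n%:R / 2 * (a%:R + b%:R + (n%:R + 1) / 2)) *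
  qpoch q (b%:R + 1) n * (qfact q M / (qfact q n * qfact q (M - n)))).
  apply: mulr_gt0; last by rewrite divr_gt0 ?mulr_gt0 ?qfact_gt0.
  apply: mulr_gt0; first exact: powR_gt0.
  by apply: qpoch_gt0; rewrite // ltr_wpDl.
move=> s; rewrite /qhahn /= -!mulrA; do 5!congr (_ * _).
rewrite /hahn_sum; pose F k := hahn_coef q a%:R b%:R M n k * hahn_basis q k s%:R.
rewrite [RHS](bigID (fun k : 'I_n.+1 => (k < (minn n s).+1)%N)) /=.
rewrite [X in _ = _ + X]big1 ?addr0 => [|k]; last first.
  move=> k1; rewrite /hahn_basis qpochN_eq0 ?mul0r ?mulr0 //.
  by have := ltn_ord k; lia.
have le_min : ((minn n s).+1 <= n.+1)%N by rewrite ltnS geq_minl.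
rewrite -(big_ord_widen n.+1 F le_min); apply: eq_bigr => k _.
rewrite /F /hahn_coef /hahn_basis.
have -> : 1 - M.+1%:R = - M%:R :> R by rewrite -natr1; ring.
have -> : k%:R * (s%:R - M.+1%:R - a%:R) =
    - (k%:R * (M%:R + 1 + a%:R)) + k%:R * s%:R :> R.
  by rewrite -natr1; ring.
rewrite powR_D // !invfM; ring.
Qed.

(** The lattice step is q^(2s-1), and the quotient of q-factorials in the weight is the square of
    the two scaling factors. The constant 1/q cancels against the same one in the norm. *)
Lemma qhahn_weightE q a b M s : 0 < q < 1 -> (s <= M)%N ->
  qhahn_weight q a%:R b%:R M.+1 s * lattice_step q s =
  (gauge q (M + b) (b + s) * gauge q (M + a) (M + a - s) *
   q `^ ((a%:R + b%:R + 2) / 2 * s%:R)) ^+ 2 / q.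
Proof.
move=> q01 sM; have q0 : 0 < q by case/andP: q01.
have h1 := qden_neq0 q01; have h2 : q != 0 by rewrite gt_eqF.
have hx z := powR_neq0 z q0.
have q1 : q `^ 1 = q by rewrite powRr1 // ltW.
rewrite !exprMn !sqr_sqrtr; try by rewrite divr_ge0 // ltW // qfact_gt0.
rewrite (_ : M + b - (b + s) = M - s)%N; last by lia.
rewrite (_ : M + a - (M + a - s) = s)%N; last by lia.
have -> : lattice_step q s = q `^ (2 * s%:R) / q.
  rewrite /lattice_step /lattice.
  have -> : 2 * (s%:R + 1 / 2) = 2 * s%:R + 1 :> R by field.
  have -> : 2 * (s%:R - 1 / 2) = 2 * s%:R - 1 :> R by field.
  rewrite !powR_D // powRN q1; field; rewrite h1 h2 //.
rewrite /qhahn_weight -natrD natrK.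
have -> : M.+1%:R + a%:R - s%:R - 1 = (M + a - s)%:R :> R.
  by rewrite natrB ?natrD -?natr1; [ring | lia].
rewrite natrK (_ : M.+1 - s - 1 = M - s)%N; last by lia.
rewrite (addnC b s) -powR_mulrn ?powR_ge0 // -powRrM.
have -> : (a%:R + b%:R + 2) / 2 * s%:R * 2 =
    (a%:R + b%:R) * s%:R + 2 * s%:R :> R by field.
rewrite powR_D //.
have h k := lt0r_neq0 (qfact_gt0 k q01).
by field; rewrite ?h ?h2.
Qed.

(** The positive prefactor P cancels between h_n and d_n. Comparing the remaining sign (-1)^n with
    that of [hahn_vec] leaves (-1)^(M-s). *)
Lemma qhahn_normalized q a b M n s : 0 < q < 1 -> (n <= M)%N -> (s <= M)%N ->
  let w t := gauge q (M + b) (b + t) * gauge q (M + a) (M + a - t) in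
  Num.sqrt (qhahn_weight q a%:R b%:R M.+1 s * lattice_step q s /
     qhahn_sqnorm q a%:R b%:R M.+1 n) * qhahn q a%:R b%:R M.+1 n s =
  (-1) ^+ (M - s) * (w s * hahn_vec q a b M n s /
   Num.sqrt (\sum_(t < M.+1) (w t * hahn_vec q a b M n t) ^+ 2)).
Proof.
move=> q01 nM sM w; have q0 : 0 < q by case/andP: q01.
have [P P0 hP] := qhahnE a b q01 nM.
set S := \sum_(t < _) _; pose e t := q `^ ((a%:R + b%:R + 2) / 2 * t%:R) : R.
have -> : qhahn_sqnorm q a%:R b%:R M.+1 n = P ^+ 2 / q * S.
  rewrite /qhahn_sqnorm /S mulr_sumr; apply: eq_bigr => t _.
  have tM : (t <= M)%N by rewrite -ltnS.
  rewrite -mulrA qhahn_weightE // hP /hahn_vec.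
  rewrite !exprMn !sqrr_sign /w; ring.
rewrite qhahn_weightE // hP -/(w s) -/(e s).
have S0 : 0 <= S by apply: sumr_ge0 => t _; exact: sqr_ge0.
have PN : P != 0 by rewrite gt_eqF.
have we0 : 0 < w s * e s / P.
  by rewrite divr_gt0 // mulr_gt0 ?powR_gt0 // mulr_gt0 // gauge_gt0.
have -> : (w s * e s) ^+ 2 / q / (P ^+ 2 / q * S) = (w s * e s / P) ^+ 2 * S^-1.
  by rewrite [(_ * S)^-1]invfM; move: S^-1 => r; field; rewrite PN gt_eqF.
rewrite sqrtrM ?sqr_ge0 // sqrtr_sqr gtr0_norm // sqrtrV //.
rewrite /hahn_vec -/(e s).
have -> : (-1) ^+ (n + M + s) = (-1) ^+ n * (-1) ^+ (M - s) :> R.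
  rewrite -exprD -signr_odd -[RHS]signr_odd !oddD oddB //.
  by case: (odd M); case: (odd s); case: (odd n).
have := sqrr_sign R (M - s).
move: ((-1) ^+ (M - s)) => si si2.
move: (Num.sqrt S)^-1 => r.
rewrite [RHS](_ : _ = si ^+ 2 *
  (w s * (-1) ^+ n * e s * hahn_sum q a%:R b%:R M n s%:R * r)); last by ring.
by rewrite si2; field.
Qed.

End HahnPolynomials.

(** * Matching real spins and weights with natural parameters *)

Theorem mainTheorem6 (R : realType) (q j1 j2 j m1 m2 : R)
    (q_gt0 : 0 < q) (q_lt1 : q < 1)
    (hj1 : is_spin j1) (hj2 : is_spin j2)
    (hj : unit_steps `|j1 - j2| (j1 + j2) j)
    (hm1 : unit_steps (- j1) j1 m1) (hm2 : unit_steps (- j2) j2 m2) :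
  let m := m1 + m2 in
  let s := Num.truncn (j2 - m2) in
  let n := Num.truncn (j - m) in
  let N := Num.truncn (j1 + j2 - m + 1) in
  let alpha := m - j1 + j2 in
  let beta := m + j1 - j2 in
  - j <= m <= j -> -1 < alpha -> -1 < beta ->
  (-1) ^+ Num.truncn (j1 - m1) * clebsch_gordan q j1 m1 j2 m2 j m =
  (Num.sqrt (qhahn_weight q alpha beta N s * lattice_step q s
             / qhahn_sqnorm q alpha beta N n)
   * qhahn q alpha beta N n s)%:C.
Proof.
move=> m s n N alpha beta /andP[_ mj] al be.
have q01 : 0 < q < 1 by rewrite q_gt0.
move: hj1 hj2 hj hm1 hm2 => [d1 j1E] [d2 j2E] [k jE jle] [x m1E xle] [y m2E yle].
have xd : (x <= d1)%N by rewrite -(ler_nat R); lra.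
have yd : (y <= d2)%N by rewrite -(ler_nat R); lra.
(* The integer alpha = x + y - d1 exceeds -1, hence is nonnegative; the same holds for beta = x + y
   - d2. *)
have ad : (d1 <= x + y)%N.
  by rewrite -ltnS -(ltr_nat R) -natr1 natrD; move: al; rewrite /alpha /m; lra.
have bd : (d2 <= x + y)%N.
  by rewrite -ltnS -(ltr_nat R) -natr1 natrD; move: be; rewrite /beta /m; lra.
(* This removes the absolute value: |j1 - j2| = max(d1, d2) - (d1 + d2) / 2. *)
pose mx := maxn d1 d2.
have jmx : j = mx%:R - (d1%:R + d2%:R) / 2 + k%:R.
  rewrite jE j1E j2E /mx; case: (leqP d1 d2) => d12.
    rewrite ler0_norm; first by field.
    by move: d12; rewrite -(ler_nat R); lra.
  rewrite ger0_norm; first by field.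
  by move: d12; rewrite -(ltr_nat R); lra.
have nmx : (x + y <= mx + k)%N.
  by rewrite -(ler_nat R) !natrD; move: mj; rewrite /m; lra.
have kmx : (mx + k <= d1 + d2)%N by rewrite -(ler_nat R) !natrD; lra.
(* These are alpha, beta, j - m, j1 + j2 - j and j2 - m2 as naturals; the inequalities above make
   the subtractions exact. *)
pose a := (x + y - d1)%N; pose b := (x + y - d2)%N.
pose n' := (mx + k - (x + y))%N; pose M := (d1 + d2 - (mx + k))%N; pose s' := (d2 - y)%N.
have mxE : mx%:R = (x + y)%:R + n'%:R - k%:R :> R.
  by rewrite /n' natrB // !natrD; ring.
have d1E : d1 = (M + (b + n'))%N by rewrite /M /b /n'; lia.
have d2E : d2 = (M + (a + n'))%N by rewrite /M /a /n'; lia.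
have xE : x = (b + s')%N by rewrite /b /s'; lia.
have yE : y = (M + n' + a - s')%N by rewrite /M /a /n' /s'; lia.
have sM : (s' <= M + n')%N by rewrite /M /n' /s'; lia.
have xyR : x%:R + y%:R = M%:R + n'%:R + a%:R + b%:R :> R.
  by rewrite -!natrD; congr (_%:R); lia.
have d1R : d1%:R = M%:R + b%:R + n'%:R :> R by rewrite {1}d1E !natrD; ring.
have d2R : d2%:R = M%:R + a%:R + n'%:R :> R by rewrite {1}d2E !natrD; ring.
have mE : m = (a%:R + b%:R) / 2 by rewrite /m m1E m2E j1E j2E; lra.
have jE' : j = (a%:R + b%:R) / 2 + n'%:R.
  by rewrite jmx mxE natrD; lra.
have alE : alpha = a%:R by rewrite /alpha mE j1E j2E; lra.
have beE : beta = b%:R by rewrite /beta mE j1E j2E; lra.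
have nE : n = n' by rewrite /n jE' mE addrC addKr natrK.
have NE : N = (M + n').+1.
  rewrite /N (_ : _ + 1 = (M + n').+1%:R) ?natrK //.
  by rewrite mE j1E j2E -(natr1 (M + n')) natrD; lra.
have sE : s = s'.
  rewrite /s (_ : _ - _ = s'%:R) ?natrK // m2E j2E /s' natrB //; lra.
have tE : Num.truncn (j1 - m1) = (M + n' - s')%N.
  rewrite (_ : _ - _ = (d1 - x)%:R) ?natrK; last by rewrite m1E j1E natrB //; lra.
  by rewrite /M /n' /s'; lia.
have m1E' : m1 = (b + s')%:R - (M + (b + n'))%:R / 2.
  by rewrite m1E j1E -xE -d1E addrC.
have m2E' : m2 = (M + n' + a - s')%:R - (M + (a + n'))%:R / 2.
  by rewrite m2E j2E -yE -d2E addrC.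
rewrite alE beE nE NE sE tE.
rewrite qhahn_normalized // ?leq_addl //.
have -> : clebsch_gordan q j1 m1 j2 m2 j m =
  clebsch_gordan q ((M + (b + n'))%:R / 2) ((b + s')%:R - (M + (b + n'))%:R / 2)
    ((M + (a + n'))%:R / 2) ((M + n' + a - s')%:R - (M + (a + n'))%:R / 2) j m.
  by rewrite -m1E' -m2E' -d1E -d2E -j1E -j2E.
rewrite (clebsch_gordanE q01 jE' mE sM) [RHS]rmorphM rmorphXn rmorphN1 /=.
have -> : (M + (b + n') = M + n' + b)%N by lia.
by have -> : (M + (a + n') = M + n' + a)%N by lia.
Qed.
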